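(* Let $P$ be a countable multiset of primes, $G=\bigoplus_{p\in P}\mathbb{Z}/p\mathbb{Z}$, and let $(X,T_g)$ be an ergodic $G$-system. Let $k\ge0$ be such that $k+1\le\min_{p\in P}p$, let $f_1,\dots,f_{k+1}\in L^\infty(X)$, and let $(\Phi_N)$ be a F{\o}lner sequence of $G$. Then the multiple ergodic average $$\mathbb{E}_{g\in\Phi_N}\,T_gf_1\cdot T_{2g}f_2\cdots T_{(k+1)g}f_{k+1}$$ converges in $L^2(X)$ as $N\to\infty$.
   Context: A $G$-system is a probability space $(X,\mathcal{B},\mu)$ (regular, i.e. $X$ is compact metric with $\mathcal{B}$ the completion of the Borel $\sigma$-algebra and $\mu$ Borel, and separable modulo null sets) with an action of $G$ by measure-preserving transformations $T_g$. For a function $f$ on $X$, $T_gf(x)=f(T_gx)$. $\mathbb{E}_{g\in\Phi_N}$ denotes the average $\frac1{|\Phi_N|}\sum_{g\in\Phi_N}$. *)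

(* Defs.v *)
From HB Require Import structures.
From mathcomp Require Import all_boot all_order all_algebra finmap.
From mathcomp Require Import all_classical all_reals all_analysis.
From mathcomp Require Import complex.

Set Implicit Arguments.
Unset Strict Implicit.
Unset Printing Implicit Defensive.

Import Order.TTheory GRing.Theory Num.Theory.
Import numFieldNormedType.Exports.

Local Open Scope classical_set_scope.
Local Open Scope ring_scope.

Section DirectSum.
Variables (I : choiceType) (V : I -> zmodType).

Record dsum := DSum {
  dsum_val :> forall i, V i;
  dsum_finite : finite_set [set i | dsum_val i != 0] }.

Lemma dsumP (x y : dsum) : (forall i, x i = y i) -> x = y.
Proof.
case: x y => [x hx] [y hy] /= xy.
have {}xy : x = y by exact: functional_extensionality_dep.
by case: y / xy hy => hy; congr DSum; exact: Prop_irrelevance.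
Qed.

HB.instance Definition _ := gen_eqMixin dsum.
HB.instance Definition _ := gen_choiceMixin dsum.

Lemma dsum_zero_finite : finite_set [set i | (0 : V i) != 0].
Proof.
by rewrite (_ : [set _ | _] = set0) // -subset0 => i /=; rewrite eqxx.
Qed.

Lemma dsum_opp_finite (x : dsum) : finite_set [set i | - x i != 0].
Proof.
by apply: sub_finite_set (dsum_finite x) => i /=; rewrite oppr_eq0.
Qed.

Lemma dsum_add_finite (x y : dsum) : finite_set [set i | x i + y i != 0].
Proof.
have /sub_finite_set : [set i | x i + y i != 0] `<=`
    [set i | x i != 0] `|` [set i | y i != 0].
  move=> i /= xy; have [x0|] := eqVneq (x i) 0; last by left.
  by right; rewrite x0 add0r in xy.
by apply; rewrite finite_setU; split; exact: dsum_finite.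
Qed.

Definition dsum_zero := DSum dsum_zero_finite.
Definition dsum_opp (x : dsum) := DSum (dsum_opp_finite x).
Definition dsum_add (x y : dsum) := DSum (dsum_add_finite x y).

Lemma dsum_addA : associative dsum_add.
Proof. by move=> x y z; apply: dsumP => i /=; exact: addrA. Qed.

Lemma dsum_addC : commutative dsum_add.
Proof. by move=> x y; apply: dsumP => i /=; exact: addrC. Qed.

Lemma dsum_add0 : left_id dsum_zero dsum_add.
Proof. by move=> x; apply: dsumP => i /=; exact: add0r. Qed.

Lemma dsum_addN : left_inverse dsum_zero dsum_opp dsum_add.
Proof. by move=> x; apply: dsumP => i /=; exact: addNr. Qed.

HB.instance Definition _ :=
  GRing.isZmodule.Build dsum dsum_addA dsum_addC dsum_add0 dsum_addN.

End DirectSum.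

(* The multiset P is the family p; its members must be primes (or at least
   greater than 1) for 'Z_(p i) to be Z/(p i)Z. *)
Definition Zsum (I : choiceType) (p : I -> nat) : zmodType :=
  dsum (fun i => ('Z_(p i) : zmodType)).

#[short(type="measurableMetricType")]
HB.structure Definition MeasurableMetric d (R : realType) :=
  {X of Metric R X & Measurable d X}.

Section Systems.
Context d (R : realType) (X : measurableMetricType d R).
Variable mu : probability X R.

Definition borel : set (set X) := <<s [set U : set X | open U] >>.

(* Null sets in the completion are subsets of Borel sets of measure zero. *)
Definition borel_completion : set (set X) :=
  [set A | exists B E N : set X,
    [/\ borel B, borel N, mu N = 0%E, E `<=` N & A = B `|` E]].

Definition separable_mod_null : Prop :=
  exists D : nat -> set X, (forall n, measurable (D n)) /\
    forall (A : set X) (e : R), measurable A -> 0 < e ->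
      exists n, (mu ((A `\` D n) `|` (D n `\` A)) < e%:E)%E.

Definition regular_measure_space : Prop :=
  [/\ compact [set: X],
      (forall A : set X, measurable A <-> borel_completion A)
    & separable_mod_null].

Variables (G : zmodType) (T : G -> X -> X).

Definition is_system : Prop :=
  [/\ regular_measure_space,
      (forall x, T 0 x = x),
      (forall g h x, T (g + h) x = T g (T h x)),
      (forall g, measurable_fun setT (T g))
    & (forall g (A : set X), measurable A -> mu (T g @^-1` A) = mu A)].

Definition is_ergodic : Prop :=
  forall A : set X, measurable A -> (forall g, T g @^-1` A = A) ->
    mu A = 0%E \/ mu A = 1%E.

(* [Re] without qualification would be the R[i]-valued 'Re of ssrnum. *)
Definition in_CLp (q : \bar R) (f : X -> R[i]) : Prop :=
  (fun x => complex.Re (f x)) \in Lfun mu q /\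
  (fun x => complex.Im (f x)) \in Lfun mu q.

Definition CL2dist (f h : X -> R[i]) : \bar R :=
  ('N[mu]_2%:E [EFin \o (fun x => ComplexField.Normc.normc (f x - h x)%R)])%E.

Definition converges_in_L2 (u : nat -> X -> R[i]) : Prop :=
  exists2 F : X -> R[i], in_CLp 2%:E F & CL2dist (u n) F @[n --> \oo] --> 0%E.

(* f j is the (j+1)-st function of the average. *)
Definition multiple_average (k : nat) (f : 'I_k.+1 -> X -> R[i])
    (A : {fset G}) (x : X) : R[i] :=
  (#|` A|%:R)^-1 * \sum_(g <- A) \prod_(j < k.+1) f j (T (g *+ j.+1) x).

End Systems.

Definition translate (G : zmodType) (g : G) (A : {fset G}) : {fset G} :=
  [fset (g + h)%R | h in A]%fset.

Definition symdiff (G : choiceType) (A B : {fset G}) : {fset G} :=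
  ((A `\` B) `|` (B `\` A))%fset.

Definition is_Folner (R : realType) (G : zmodType) (Phi : nat -> {fset G}) :=
  (forall N, Phi N != fset0) /\
  forall g : G,
    (#|` symdiff (translate g (Phi N)) (Phi N)|%:R / #|` Phi N|%:R : R)
      @[N --> \oo] --> (0 : R).

(* Main.v *)
(* The argument is Walsh's proof of norm convergence, simplified by G being
   locally finite: averages over cosets of finite subgroups H have no boundary
   effects. By induction on the number of functions, along every increasing
   chain (H_j) of finite subgroups there is a j, bounded uniformly over all
   systems and all functions bounded by 1, such that the averages over the
   cosets a + H_j with a in H_{j+1} are all close in L^2. For the induction
   step, decompose the last function as B r + q by an energy decrement argument.
   Here r is a convex combination of dual functions at a large scale H', so that
   r(T_{kh} x), for h in H', is an average of products of functions of T_{ih} x,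
   i < k, which removes the last function at the cost of a product system. The
   remainder q hardly correlates with dual functions at a small scale, hence its
   averages are small. Applied to chains built from a counterexample, this gives
   for each e a finite H all of whose coset averages are e-close to the average
   over H. Averages along a Folner sequence are nearly averages of those coset
   averages, so they are Cauchy. *)
Require Import Defs.
From mathcomp Require Import all_boot all_order all_algebra finmap.
From mathcomp Require Import all_classical all_reals all_analysis.
From mathcomp Require Import complex measurable_realfun ess_sup_inf.
From mathcomp Require Import ring lra.

Set Implicit Arguments.
Unset Strict Implicit.
Unset Printing Implicit Defensive.

Import Order.TTheory GRing.Theory Num.Theory.
Import numFieldNormedType.Exports.
Local Open Scope ring_scope.

(** * Systems with an invariant mean *)

(* An algebra of functions with an invariant mean, closed under finite weighted
   products (prod_system), to which the uniform statement below is applied. The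
   mean of 1 may be less than 1, so that a product needs weights of sum at most
   1 only. *)
Record psystem (R : realType) (G : zmodType) (X : Type) := PSystem {
  obs : (X -> R) -> Prop;
  mean : (X -> R) -> R;
  act : G -> X -> X;
  obs_cst : forall c, obs (fun=> c);
  obsD : forall f g, obs f -> obs g -> obs (fun x => f x + g x);
  obsM : forall f g, obs f -> obs g -> obs (fun x => f x * g x);
  obs_act : forall a f, obs f -> obs (fun x => f (act a x));
  meanD : forall f g, obs f -> obs g ->
    mean (fun x => f x + g x) = mean f + mean g;
  meanZ : forall c f, obs f -> mean (fun x => c * f x) = c * mean f;
  mean_ge0 : forall f, obs f -> (forall x, 0 <= f x) -> 0 <= mean f;
  mean1_le : mean (fun=> 1) <= 1;
  mean_act : forall a f, obs f -> mean (fun x => f (act a x)) = mean f;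
  act0 : forall x, act 0 x = x;
  actD : forall a b x, act (a + b) x = act a (act b x) }.

Section PSystemTheory.
Variables (R : realType) (G : zmodType) (X : Type) (S : psystem R G X).
Implicit Types (f g : X -> R) (a b : G).

Lemma obsN f : obs S f -> obs S (fun x => - f x).
Proof.
move=> of_; rewrite (_ : (fun x => _) = fun x => (fun=> -1) x * f x).
  by apply: obsM => //; exact: obs_cst.
by apply: funext => x; rewrite mulN1r.
Qed.

Lemma obsB f g : obs S f -> obs S g -> obs S (fun x => f x - g x).
Proof. by move=> of_ og; apply: (obsD of_ (obsN og)). Qed.

Lemma obsX f n : obs S f -> obs S (fun x => f x ^+ n).
Proof.
move=> of_; elim: n => [|n IH]; first exact: obs_cst.
rewrite (_ : (fun x => _) = fun x => f x * f x ^+ n); first exact: obsM.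
by apply: funext => x; rewrite exprS.
Qed.

Lemma obs_sum (J : Type) (s : seq J) (F : J -> X -> R) :
  (forall j, obs S (F j)) -> obs S (fun x => \sum_(j <- s) F j x).
Proof.
move=> oF; elim: s => [|j s IH].
  rewrite (_ : (fun x => _) = fun=> 0); first exact: obs_cst.
  by apply: funext => x; rewrite big_nil.
rewrite (_ : (fun x => _) = fun x => F j x + \sum_(i <- s) F i x).
  exact: obsD.
by apply: funext => x; rewrite big_cons.
Qed.

Lemma obs_prod (J : Type) (s : seq J) (F : J -> X -> R) :
  (forall j, obs S (F j)) -> obs S (fun x => \prod_(j <- s) F j x).
Proof.
move=> oF; elim: s => [|j s IH].
  rewrite (_ : (fun x => _) = fun=> 1); first exact: obs_cst.
  by apply: funext => x; rewrite big_nil.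
rewrite (_ : (fun x => _) = fun x => F j x * \prod_(i <- s) F i x).
  exact: obsM.
by apply: funext => x; rewrite big_cons.
Qed.

Lemma meanN f : obs S f -> mean S (fun x => - f x) = - mean S f.
Proof.
move=> of_; rewrite -mulN1r -meanZ//; congr (mean S _).
by apply: funext => x; rewrite mulN1r.
Qed.

Lemma meanB f g : obs S f -> obs S g ->
  mean S (fun x => f x - g x) = mean S f - mean S g.
Proof. by move=> of_ og; rewrite meanD ?meanN//; exact: obsN. Qed.

Lemma mean0 : mean S (fun=> 0) = 0.
Proof.
transitivity (mean S (fun x => 0 * 1)); last first.
  by rewrite meanZ ?mul0r//; exact: obs_cst.
by congr (mean S _); apply: funext => x; rewrite mul0r.
Qed.

Lemma mean_sum (J : Type) (s : seq J) (F : J -> X -> R) :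
  (forall j, obs S (F j)) ->
  mean S (fun x => \sum_(j <- s) F j x) = \sum_(j <- s) mean S (F j).
Proof.
move=> oF; elim: s => [|j s IH].
  rewrite big_nil -[RHS]mean0; congr (mean S _).
  by apply: funext => x; rewrite big_nil.
rewrite big_cons -IH -meanD//; last exact: obs_sum.
by congr (mean S _); apply: funext => x; rewrite big_cons.
Qed.

Lemma ler_mean f g : obs S f -> obs S g -> (forall x, f x <= g x) ->
  mean S f <= mean S g.
Proof.
move=> of_ og fg; rewrite -subr_ge0 -meanB//; apply: mean_ge0; first exact: obsB.
by move=> x; rewrite subr_ge0.
Qed.

(** The mean of 1 may be less than 1, so an upper bound passes to the mean only when it is
    nonnegative. *)
Lemma mean_le_cst f c : 0 <= c -> obs S f -> (forall x, f x <= c) ->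
  mean S f <= c.
Proof.
move=> c0 of_ fc; apply: (@le_trans _ _ (mean S (fun x => c * 1))).
  by apply: ler_mean => [//||x]; [exact: obs_cst|rewrite mulr1].
by rewrite meanZ; [rewrite ler_piMr// mean1_le|exact: obs_cst].
Qed.

(** The bound is pointwise, since a [psystem] has no notion of null set. *)
Definition bobs f := obs S f /\ forall x, `|f x| <= 1.

Lemma bobs_act a f : bobs f -> bobs (fun x => f (act S a x)).
Proof. by move=> [of_ f1]; split=> //; exact: obs_act. Qed.

Lemma bobsM f g : bobs f -> bobs g -> bobs (fun x => f x * g x).
Proof.
move=> [of_ f1] [og g1]; split=> [|x]; first exact: obsM.
by rewrite normrM mulr_ile1.
Qed.

Lemma prodr_norm_le1 (F : nat -> R) k : (forall i, `|F i| <= 1) ->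
  `|\prod_(i < k) F i| <= 1.
Proof.
move=> F1; rewrite normr_prod.
by apply: Num.Theory.prodr_ile1 => i _; rewrite normr_ge0 F1.
Qed.

(** The average over the translate [a + A]. The family [f] is indexed by all of [nat], and its first
    [k] entries count, so that one family serves every [k]. *)
Definition mavg k (f : nat -> X -> R) (A : {fset G}) a x : R :=
  (#|` A|%:R)^-1 * \sum_(g <- A) \prod_(i < k) f i (act S ((a + g) *+ i.+1) x).

Lemma obs_mavg k (f : nat -> X -> R) A a :
  (forall i, obs S (f i)) -> obs S (mavg k f A a).
Proof.
move=> of_; apply: (obsM (obs_cst _ _)); apply: obs_sum => g.
by apply: obs_prod => i; exact: obs_act.
Qed.

End PSystemTheory.

Section Means.
Variables (R : realType) (G : zmodType).

(** The sign of [c] covers an empty [A], over which the average is 0. *)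
Lemma fmean_le (A : {fset G}) (F : G -> R) c :
  0 <= c -> (forall g, g \in A -> F g <= c) ->
  (#|` A|%:R)^-1 * \sum_(g <- A) F g <= c.
Proof.
move=> c0 Fc; have [A0|A0] := posnP #|` A|.
  by rewrite A0 invr0 mul0r.
rewrite mulrC ler_pdivrMr ?ltr0n//.
rewrite big_seq (le_trans (ler_sum _ Fc))// -big_seq.
by rewrite big_const_seq count_predT iter_addr_0 mulr_natr.
Qed.

Lemma fmean_cst (c : R) (A : {fset G}) : A != fset0 ->
  (#|` A|%:R)^-1 * \sum_(g <- A) c = c.
Proof.
rewrite -cardfs_gt0 => A0.
rewrite big_const_seq count_predT iter_addr_0 -[c *+ _]mulr_natl mulrA.
by rewrite mulVf ?mul1r// pnatr_eq0 -lt0n.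
Qed.

Lemma fmean_norm_le (A : {fset G}) (F : G -> R) c :
  0 <= c -> (forall g, g \in A -> `|F g| <= c) ->
  `|(#|` A|%:R)^-1 * \sum_(g <- A) F g| <= c.
Proof.
move=> c0 Fc; rewrite normrM ger0_norm ?invr_ge0//.
apply: (@le_trans _ _ ((#|` A|%:R)^-1 * \sum_(g <- A) `|F g|)).
  by rewrite ler_wpM2l ?invr_ge0// ler_norm_sum.
by apply: fmean_le.
Qed.

End Means.

Lemma mavg_norm_le1 (R : realType) (G : zmodType) (X : Type)
    (S : psystem R G X) k f A a x :
  (forall i, bobs S (f i)) -> `|mavg S k f A a x| <= 1.
Proof.
move=> f1; apply: fmean_norm_le => // g _.
by apply: (@prodr_norm_le1 _ (fun i => f i (act S ((a + g) *+ i.+1) x))) => i;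
  case: (f1 i).
Qed.

Section Subgroups.
Variables (R : realType) (G : zmodType).
Implicit Types (H K : {fset G}).

Definition fsubgroup H := 0 \in H /\ {in H &, forall a b, a - b \in H}.

Lemma fsubgroupN H a : fsubgroup H -> a \in H -> - a \in H.
Proof. by move=> [H0 HB] Ha; rewrite -sub0r HB. Qed.

Lemma fsubgroupD H a b : fsubgroup H -> a \in H -> b \in H -> a + b \in H.
Proof. by move=> HH Ha Hb; rewrite -[b]opprK HH.2// fsubgroupN. Qed.

Lemma fsubgroup_neq0 H : fsubgroup H -> H != fset0.
Proof. by case=> H0 _; apply/fset0Pn; exists 0. Qed.

Lemma fsubgroup_sum_shift H a (F : G -> R) : fsubgroup H -> a \in H ->
  \sum_(g <- H) F (a + g) = \sum_(g <- H) F g.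
Proof.
move=> HH Ha; rewrite -(big_map (fun g => a + g) xpredT F); apply: perm_big.
apply: uniq_perm; rewrite ?(map_inj_uniq (addrI a)) ?fset_uniq//.
move=> g; apply/mapP/idP => [[h Hh ->]|Hg]; first exact: fsubgroupD.
by exists (- a + g); rewrite ?addNKr// ?addKr// fsubgroupD// fsubgroupN.
Qed.

End Subgroups.

Section ProductSystem.
Variables (R : realType) (G : zmodType) (X : Type) (S : psystem R G X).
Variables (W : Type) (s : seq W) (l : W -> R).
Hypotheses (l_ge0 : forall v, 0 <= l v) (l_le1 : \sum_(v <- s) l v <= 1).

Let pobs (F : W * X -> R) := forall v, obs S (fun x => F (v, x)).
Let pmean (F : W * X -> R) := \sum_(v <- s) l v * mean S (fun x => F (v, x)).
Let pact (a : G) (y : W * X) := (y.1, act S a y.2).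

(** One copy of [X] for each entry of [s], weighted by [l], with the group acting inside each copy.
    The mean of 1 is at most the sum of the weights. *)
Definition prod_system : psystem R G (W * X).
Proof.
refine (@PSystem R G (W * X) pobs pmean pact _ _ _ _ _ _ _ _ _ _ _).
- by move=> c v; exact: obs_cst.
- by move=> f g hf hg v; exact: obsD.
- by move=> f g hf hg v; exact: obsM.
- by move=> a f hf v; exact: (obs_act a (hf v)).
- move=> f g hf hg; rewrite /pmean -big_split; apply: eq_bigr => v _ /=.
  by rewrite -mulrDr -meanD.
- move=> c f hf; rewrite /pmean mulr_sumr; apply: eq_bigr => v _ /=.
  by rewrite meanZ// mulrCA.
- move=> f hf f0; apply: sumr_ge0 => v _; rewrite mulr_ge0//.
  by apply: mean_ge0.
- apply: le_trans l_le1; apply: ler_sum => v _.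
  by rewrite ler_piMr// mean1_le.
- move=> a f hf; apply: eq_bigr => v _; congr (_ * _).
  exact: (mean_act a (hf v)).
- by move=> [v x]; rewrite /pact /= act0.
- by move=> a b [v x]; rewrite /pact /= actD.
Defined.

Lemma obs_prod_system F :
  obs prod_system F <-> forall v, obs S (fun x => F (v, x)).
Proof. by []. Qed.

End ProductSystem.

Arguments prod_system : simpl never.

(** * Reducible functions *)

Section Reducible.
Variables (R : realType) (G : zmodType) (X : Type) (S : psystem R G X).
Implicit Types (H : {fset G}) (k : nat).

(* Along the orbit of [H] under the [k.+1]-st action, a reducible function is
   an average of products in which only the first [k] actions occur. *)
Definition reducible k H (r : X -> R) :=
  exists (W : Type) (s : seq W) (l : W -> R) (w : W -> X -> R)
         (u : W -> nat -> X -> R),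
    [/\ forall v, 0 <= l v, \sum_(v <- s) l v <= 1, forall v, bobs S (w v),
        forall v i, bobs S (u v i)
      & forall h x, h \in H -> r (act S (h *+ k.+1) x) =
          \sum_(v <- s) l v * (w v x * \prod_(i < k) u v i (act S (h *+ i.+1) x))].

Lemma reducible_sub k H K r : (H `<=` K)%fset -> reducible k K r ->
  reducible k H r.
Proof.
move=> /fsubsetP HK [W [s [l [w [u [? ? ? ? E]]]]]].
by exists W, s, l, w, u; split=> // h x /HK; exact: E.
Qed.

(** The empty combination, from which the energy decrement starts. *)
Lemma reducible0 k H : reducible k H (fun=> 0).
Proof.
exists unit, [::], (fun=> 0), (fun=> fun=> 0), (fun=> fun=> fun=> 0).
have b0 : bobs S (fun=> 0) by split=> [|x]; [exact: obs_cst|rewrite normr0].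
by split=> // [|h x _]; rewrite big_nil.
Qed.

(** At [h = 0] the action is trivial, so the defining formula describes [r] itself and bounds it by
    the sum of the weights. *)
Lemma reducible_bobs k H r : 0 \in H -> reducible k H r -> bobs S r.
Proof.
move=> H0 [W [s [l [w [u [l0 l1 w1 u1 E]]]]]].
have {}E x : r x =
    \sum_(v <- s) l v * (w v x * \prod_(i < k) u v i (act S (0 *+ i.+1) x)).
  by rewrite -E// mul0rn act0.
rewrite (_ : r = fun x => \sum_(v <- s) l v *
    (w v x * \prod_(i < k) u v i (act S (0 *+ i.+1) x))); last exact: funext.
split=> [|x].
  apply: obs_sum => v; apply: (obsM (obs_cst _ _)); apply: obsM.
    by have [] := w1 v.
  by apply: obs_prod => i; apply: obs_act; have [] := u1 v i.
apply: le_trans (ler_norm_sum _ _ _) _; apply: le_trans l1.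
apply: ler_sum => v _; rewrite normrM ger0_norm// ler_piMr// normrM.
have [_ w1v] := w1 v; rewrite mulr_ile1//.
apply: (@prodr_norm_le1 _ (fun i => u v i (act S (0 *+ i.+1) x))) => i.
by have [_] := u1 v i.
Qed.

(** Concatenate the two lists, over the sum of their index types, with weights scaled by [1 - t] and
    [t]. *)
Lemma reducible_conv k H r1 r2 t : 0 <= t -> t <= 1 ->
  reducible k H r1 -> reducible k H r2 ->
  reducible k H (fun x => (1 - t) * r1 x + t * r2 x).
Proof.
move=> t0 t1 [W1 [s1 [l1 [w1 [u1 [l10 l11 w11 u11 E1]]]]]].
move=> [W2 [s2 [l2 [w2 [u2 [l20 l21 w21 u21 E2]]]]]].
pose app T (f1 : W1 -> T) (f2 : W2 -> T) v :=
  match v with inl v1 => f1 v1 | inr v2 => f2 v2 end.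
exists (W1 + W2)%type, (map inl s1 ++ map inr s2),
  (app R (fun v => (1 - t) * l1 v) (fun v => t * l2 v)),
  (app (X -> R) w1 w2), (app (nat -> X -> R) u1 u2); split.
- by case=> v /=; rewrite mulr_ge0// subr_ge0.
- rewrite big_cat !big_map /= -!mulr_sumr.
  have t1' : 0 <= 1 - t by rewrite subr_ge0.
  by rewrite (le_trans (lerD (ler_wpM2l t1' l11) (ler_wpM2l t0 l21)))//; lra.
- by case.
- by case.
- move=> h x Hh; rewrite big_cat !big_map /= E1// E2// !mulr_sumr.
  by congr (_ + _); apply: eq_bigr => v _; exact: mulrA.
Qed.

(* Dual functions are reducible, since translating the summation index by
   [h \in H] moves the last action onto the other factors. *)
Lemma mean_mavg_last k H K (f : nat -> X -> R) W a u c :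
  fsubgroup H -> (K `<=` H)%fset ->
  (forall i, (i < k)%N -> bobs S (f i)) -> f k = u -> obs S u -> bobs S W ->
  (forall r, reducible k K r -> mean S (fun x => u x * r x) <= c) ->
  mean S (fun x => W x * mavg S k.+1 f H a x) <= c.
Proof.
move=> HH KH f1 fk ou W1 uc.
pose m : R := (#|` H|%:R)^-1.
pose P g y := \prod_(i < k) f i (act S ((a + g) *+ i.+1) y).
(* The dual function: translation by [- ((a + g) *+ k.+1)] brings the argument of [u] in the summand
   of [g] back to [x]. *)
pose r x := \sum_(g <- H) m * (W (act S (- ((a + g) *+ k.+1)) x) *
                               P g (act S (- ((a + g) *+ k.+1)) x)).
have oP g : obs S (P g).
  by apply: obs_prod => i; apply: obs_act; have [] := f1 _ (ltn_ord i).
have oWP g : obs S (fun y => W y * P g y) by apply: obsM => //; case: W1.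
have -> : mean S (fun x => W x * mavg S k.+1 f H a x) =
          mean S (fun x => u x * r x).
  transitivity (mean S (fun x => \sum_(g <- H) m *
      ((W x * P g x) * u (act S ((a + g) *+ k.+1) x)))).
    congr (mean S _); apply: funext => x; rewrite /mavg mulrCA !mulr_sumr.
    apply: eq_bigr => g _; by rewrite big_ord_recr /= fk -/(P g x) -[in RHS]mulrA.
  have o1 g : obs S (fun x => (W x * P g x) * u (act S ((a + g) *+ k.+1) x)).
    by apply: obsM => //; exact: obs_act.
  rewrite mean_sum; last by move=> g; apply: (obsM (obs_cst _ _)).
  transitivity (mean S (fun x => \sum_(g <- H) m * (u x *
     (W (act S (- ((a + g) *+ k.+1)) x) * P g (act S (- ((a + g) *+ k.+1)) x))))).
    have o2 g : obs S (fun x => u x * (W (act S (- ((a + g) *+ k.+1)) x) *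
        P g (act S (- ((a + g) *+ k.+1)) x))).
      by apply: obsM => //; exact: (obs_act _ (oWP g)).
    rewrite mean_sum; last by move=> g; apply: (obsM (obs_cst _ _)).
    apply: eq_bigr => g _; rewrite !meanZ//; congr (_ * _).
    rewrite -(mean_act (- ((a + g) *+ k.+1)) (o1 g)); congr (mean S _).
    by apply: funext => x; rewrite -actD subrr act0 mulrC.
  congr (mean S _); apply: funext => x; rewrite /r mulr_sumr.
  by apply: eq_bigr => g _; rewrite mulrCA.
apply: uc; apply: (reducible_sub KH).
(* Uniform weights on [H]. Entries from [k] on are set to 0, as [f i] is known to be bounded only
   for [i < k]. *)
exists G, (H : seq G), (fun=> m), (fun g x => W (act S (- ((a + g) *+ k.+1)) x)),
  (fun g i x => if (i < k)%N then
      f i (act S ((a + g) *+ i.+1) (act S (- ((a + g) *+ k.+1)) x)) else 0).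
split.
- by move=> _; rewrite invr_ge0.
- have := fmean_cst (1 : R) (fsubgroup_neq0 HH).
  by rewrite mulr_sumr mulr1 => ->.
- by move=> g; exact: (bobs_act (- ((a + g) *+ k.+1)) W1).
- move=> g i; case ik: (i < k)%N.
    exact: (bobs_act (- ((a + g) *+ k.+1))
                     (bobs_act ((a + g) *+ i.+1) (f1 i ik))).
  by split=> [|x]; [exact: obs_cst|rewrite normr0].
- move=> h x Hh; rewrite /r -(fsubgroup_sum_shift _ HH Hh).
  apply: eq_bigr => g _; congr (_ * _).
  have E : - ((a + (h + g)) *+ k.+1) + h *+ k.+1 = - ((a + g) *+ k.+1).
    by rewrite (addrCA a h) mulrnDl opprD addrAC addNr add0r.
  rewrite -actD E; congr (_ * _); apply: eq_bigr => i _.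
  rewrite ltn_ord; congr (f i _); rewrite -!actD; congr (act S _ x).
  by rewrite (addrCA a h) mulrnDl -addrA addrC.
Qed.

End Reducible.

(** * Energy decrement *)

Section Energy.
Variables (R : realType) (G : zmodType) (X : Type) (S : psystem R G X).
Variables (k : nat) (f : X -> R) (f1 : bobs S f).
Implicit Types (H : {fset G}) (B e : R).

Let energy B (r : X -> R) := mean S (fun x => (f x - B * r x) ^+ 2).

(* Were there no such [i], improving [r] along the chain, from [C J] down to
   [C 0], would lower its energy by [e] at each of the [J] steps. *)
Lemma energy_decrement B e (C : nat -> {fset G}) J r :
  reducible S k (C J) r ->
  (exists i r', [/\ (i < J)%N, reducible S k (C i.+1) r' &
     forall r'', reducible S k (C i) r'' -> energy B r' <= energy B r'' + e]) \/
  (exists2 r', reducible S k (C 0%N) r' & energy B r' <= energy B r - J%:R * e).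
Proof.
elim: J r => [|J IH] r red_r; first by right; exists r => //; rewrite mul0r subr0.
have [min_r|/existsNP[r' /not_implyP[red_r' /negP]]] :=
  pselect (forall r'', reducible S k (C J) r'' -> energy B r <= energy B r'' + e).
  by left; exists J, r; split.
rewrite -ltNge => lt_r'.
have [[i [r'' [iJ ? ?]]]|[r'' ? le_r'']] := IH _ red_r'.
  by left; exists i, r''; split=> //; exact: ltnW.
right; exists r'' => //; apply: (le_trans le_r'').
by rewrite -natr1 mulrDl mul1r; lra.
Qed.

(* Compare the energy of [r] with that of the convex combination
   [(1 - t) r + t r']. *)
Lemma near_minimizer_corr B t H r r' : 0 < B -> 0 < t -> t <= 1 -> 0 \in H ->
  reducible S k H r ->
  (forall r'', reducible S k H r'' -> energy B r <= energy B r'' + (t * B) ^+ 2) ->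
  reducible S k H r' ->
  mean S (fun x => (f x - B * r x) * r' x) <= (4 * B)^-1 + 5 / 2 * (t * B).
Proof.
move=> B0 t0 t1 H0 red_r min_r red_r'.
have [or r1] := reducible_bobs H0 red_r; have [or' r1'] := reducible_bobs H0 red_r'.
have [of_ f1'] := f1.
pose u x := f x - B * r x.
have ou : obs S u by apply: obsB => //; apply: obsM => //; exact: obs_cst.
have our' : obs S (fun x => u x * r' x) by exact: obsM.
have our : obs S (fun x => u x * r x) by exact: obsM.
have ouu : obs S (fun x => u x ^+ 2) by exact: obsX.
have obsZ c g : obs S g -> obs S (fun x => c * g x).
  by apply: obsM; exact: obs_cst.
(* Pointwise, [B u r = u (f - u) <= f ^ 2 / 4 <= 1 / 4]. *)
have corr_r : mean S (fun x => u x * r x) <= (4 * B)^-1.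
  rewrite -(ler_pM2l B0) -meanZ// invfM mulrCA divff ?gt_eqF// mulr1.
  apply: mean_le_cst; [by []|exact: obsZ|] => x.
  have : 0 <= (u x - 2^-1 * f x) ^+ 2 by exact: sqr_ge0.
  have : f x ^+ 2 <= 1 by rewrite -[f x ^+ 2]ger0_norm ?sqr_ge0// normrX exprn_ile1.
  by rewrite /u; nra.
(* Passing to the convex combination changes the energy by [- 2 t B c + (t B) ^ 2 m], where [c] is
   the left-hand side and [m <= 4]. Near-minimality then gives [2 t B c <= 5 (t B) ^ 2]. *)
have le_corr : mean S (fun x => u x * r' x) - mean S (fun x => u x * r x) <=
    5 / 2 * (t * B).
  have := min_r _ (reducible_conv (ltW t0) t1 red_r red_r').
  rewrite /energy -[mean S (fun x => (f x - B * r x) ^+ 2)]/(mean S (fun x => u x ^+ 2)).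
  have -> : mean S (fun x => (f x - B * ((1 - t) * r x + t * r' x)) ^+ 2) =
      mean S (fun x => u x ^+ 2) - 2 * (t * B) *
        (mean S (fun x => u x * r' x) - mean S (fun x => u x * r x)) +
      (t * B) ^+ 2 * mean S (fun x => (r' x - r x) ^+ 2).
    rewrite -meanB// -!meanZ//; last 2 first.
    - by apply: obsX; exact: obsB.
    - exact: obsB.
    rewrite -meanB//; last by apply: obsZ; exact: obsB.
    rewrite -meanD//; last 2 first.
    - by apply: obsB => //; apply: obsZ; exact: obsB.
    - by apply: obsZ; apply: obsX; exact: obsB.
    by congr (mean S _); apply: funext => x; rewrite /u; ring.
  have le4 : mean S (fun x => (r' x - r x) ^+ 2) <= 4.
    apply: mean_le_cst => //; first by apply: obsX; exact: obsB.
    move=> x; have := r1 x; have := r1' x; rewrite !ler_norml => /andP[? ?] /andP[? ?].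
    by nra.
  have tB0 : 0 < t * B by exact: mulr_gt0.
  move=> min_t; rewrite -(ler_pM2l tB0).
  have := ler_wpM2l (sqr_ge0 (t * B)) le4; move: min_t.
  move: (mean S (fun x => u x ^+ 2)) (mean S (fun x => (r' x - r x) ^+ 2)).
  move: (mean S (fun x => u x * r' x) - mean S (fun x => u x * r x)) => c1 c2 c3.
  set c4 := t * B; lra.
change (mean S (fun x => u x * r' x) <= (4 * B)^-1 + 5 / 2 * (t * B)).
by rewrite -[leLHS](subrK (mean S (fun x => u x * r x))) addrC lerD.
Qed.

End Energy.

(** * Uniform stability of averages over finite subgroups *)

Section Stability.
Variables (R : realType) (G : zmodType).
Implicit Types (H K : {fset G}) (k : nat).

Definition stabilizes (X : Type) (S : psystem R G X) k (f : nat -> X -> R) H K e :=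
  forall a b, a \in K -> b \in K ->
    mean S (fun x => (mavg S k f H a x - mavg S k f H b x) ^+ 2) <= e.

(* [N] depends neither on the system nor on the functions. *)
Definition uniformly_stable k := forall (e : R) (H : nat -> {fset G}),
  0 < e -> e <= 1 -> (forall j, fsubgroup (H j)) ->
  (forall j, (H j `<=` H j.+1)%fset) ->
  exists N, forall (X : Type) (S : psystem R G X) (f : nat -> X -> R),
    (forall i, bobs S (f i)) ->
    exists2 j, (j < N)%N & stabilizes S k f (H j) (H j.+1) e.

Lemma uniformly_stable0 : uniformly_stable 0.
Proof.
move=> e H e0 _ Hs _; exists 1%N => X S f f1; exists 0%N => // a b _ _.
have E c x : mavg S 0 f (H 0%N) c x = (#|` H 0%N|%:R)^-1 * \sum_(g <- H 0%N) 1.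
  by congr (_ * _); apply: eq_bigr => g _; rewrite big_ord0.
apply: le_trans (ltW e0); rewrite -(mean0 S) le_eqVlt; apply/orP; left; apply/eqP.
by congr (mean S _); apply: funext => x; rewrite !E subrr expr0n.
Qed.

Definition set_last T k (f : nat -> T) v i := if i == k then v else f i.

Lemma mavgS X (S : psystem R G X) k f v H a x :
  mavg S k.+1 (set_last k f v) H a x = (#|` H|%:R)^-1 * \sum_(g <- H)
    (\prod_(i < k) f i (act S ((a + g) *+ i.+1) x) * v (act S ((a + g) *+ k.+1) x)).
Proof.
congr (_ * _); apply: eq_bigr => g _; rewrite big_ord_recr /= /set_last eqxx.
by congr (_ * _); apply: eq_bigr => i _; rewrite ltn_eqF.
Qed.

Lemma mavg_set_lastD X (S : psystem R G X) k f v1 v2 c H a x :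
  mavg S k.+1 (set_last k f (fun y => c * v1 y + v2 y)) H a x =
  c * mavg S k.+1 (set_last k f v1) H a x + mavg S k.+1 (set_last k f v2) H a x.
Proof.
rewrite !mavgS mulrCA [c * _]mulr_sumr -mulrDr -big_split; congr (_ * _).
by apply: eq_bigr => g _ /=; rewrite mulrDr mulrCA.
Qed.

Lemma set_last_id T k (f : nat -> T) : set_last k f (f k) = f.
Proof. by apply: funext => i; rewrite /set_last; case: eqP => // ->. Qed.

End Stability.

(** * Induction on the number of functions *)

Section Induction.
Variables (R : realType) (G : zmodType).

Lemma fsubset_chain (H : nat -> {fset G}) i j :
  (forall n, (H n `<=` H n.+1)%fset) -> (i <= j)%N -> (H i `<=` H j)%fset.
Proof.
move=> Hs /subnKC <-; elim: (j - i)%N => [|n IH]; first by rewrite addn0.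
by rewrite addnS (fsubset_trans IH).
Qed.

(* This turns an average of [k.+1] functions, the last one reducible, into an
   average of [k] functions on a product system. *)
Lemma mavg_reducible (X : Type) (S : psystem R G X) k f r (H K : {fset G})
    (W : Type) (s : seq W) (l : W -> R) (w : W -> X -> R)
    (u : W -> nat -> X -> R) (l0 : forall v, 0 <= l v)
    (l1 : \sum_(v <- s) l v <= 1) a x :
  fsubgroup K -> (H `<=` K)%fset -> a \in K ->
  (forall h x, h \in K -> r (act S (h *+ k.+1) x) =
     \sum_(v <- s) l v * (w v x * \prod_(i < k) u v i (act S (h *+ i.+1) x))) ->
  mavg S k.+1 (set_last k f r) H a x = \sum_(v <- s) l v * (w v x *
    mavg (prod_system S l0 l1) k (fun i y => f i y.2 * u y.1 i y.2) H a (v, x)).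
Proof.
move=> HK /fsubsetP sHK Ka rE; rewrite mavgS.
transitivity ((#|` H|%:R)^-1 * \sum_(g <- H) \sum_(v <- s) l v * (w v x *
   \prod_(i < k) (f i (act S ((a + g) *+ i.+1) x) *
                  u v i (act S ((a + g) *+ i.+1) x)))).
  congr (_ * _); rewrite big_seq [RHS]big_seq; apply: eq_bigr => g Hg.
  rewrite rE; last by rewrite fsubgroupD// sHK.
  rewrite mulr_sumr; apply: eq_bigr => v _; rewrite big_split /=.
  by rewrite mulrCA; congr (_ * _); rewrite mulrCA.
rewrite exchange_big mulr_sumr; apply: eq_bigr => v _ /=.
by rewrite -mulr_sumr mulrCA; congr (_ * _); rewrite -mulr_sumr mulrCA.
Qed.

(** The chain is thinned to [H (c i)], each gap being long enough for the induction hypothesis to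
    act inside it. The energy decrement picks a gap such that [r] is reducible at its upper end, as
    the product system requires, and nearly minimal at its lower end, so that [q] hardly correlates
    with dual functions at any scale inside the gap. *)
Lemma uniformly_stableS k : uniformly_stable R G k -> uniformly_stable R G k.+1.
Proof.
move=> IH e H e0 e1 Hs Hinc.
(* [f k = B r + q], where [q] contributes at most [4 d = e / 2] and [B r] at most
   [B (5 / 2) n = e / 2] to the mean square below. *)
pose d := e / 8; pose B : R := (2 * d)^-1; pose t := 2 / 5 * d ^+ 2.
have d0 : 0 < d by rewrite divr_gt0.
have d1 : d <= 1 by rewrite /d; lra.
have B0 : 0 < B by rewrite invr_gt0 mulr_gt0.
have t0 : 0 < t by rewrite mulr_gt0 ?exprn_gt0// divr_gt0.
have t1 : t <= 1 by rewrite /t; nra.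
(* This choice of [t] makes the bound [(4 B)^-1 + 5 / 2 (t B)] of [near_minimizer_corr] equal to
   [d / 2 + d / 2]. *)
have tB : t * B = d / 5 by rewrite /t /B; field; rewrite gt_eqF.
pose n := e ^+ 2 / 20.
have n0 : 0 < n by rewrite divr_gt0 ?exprn_gt0.
have n1 : n ^+ 2 <= 1 by rewrite /n exprn_ile1// ?divr_ge0 ?sqr_ge0//; nra.
(* The induction hypothesis for the tail of the chain from [c] on; the resulting [N] is the length
   of a gap starting at [c]. *)
have IHc c : exists N, forall (X : Type) (S : psystem R G X) (f : nat -> X -> R),
    (forall i, bobs S (f i)) ->
    exists2 j, (j < N)%N & stabilizes S k f (H (c + j)%N) (H (c + j).+1) (n ^+ 2).
  have [||N HN] := IH (n ^+ 2) (fun j => H (c + j)%N) (exprn_gt0 2 n0) n1 => //.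
    by move=> j; rewrite addnS.
  by exists N => X S f /HN[j jN st]; exists j => //; rewrite -addnS.
have [N HN] := choice IHc.
pose c i := iter i (fun c => c + N c)%N 0%N.
have cS i : c i.+1 = (c i + N (c i))%N by [].
have c_le i j : (i <= j)%N -> (c i <= c j)%N.
  move=> /subnKC <-; elim: (j - i)%N => [|m IHm]; first by rewrite addn0.
  by rewrite addnS cS (leq_trans IHm)// leq_addr.
pose J := (Num.truncn ((t * B) ^+ 2)^-1).+1.
have tB0 : 0 < (t * B) ^+ 2 by rewrite exprn_gt0// mulr_gt0.
have J1 : 1 < J%:R * (t * B) ^+ 2.
  by rewrite -ltr_pdivrMr// mul1r truncnS_gt.
exists (c J) => X S f f1.
(* The energy of [r = 0] is at most 1, less than [J] decrements, so the second alternative would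
   make an energy negative. *)
have [|[r red_r]] := energy_decrement (f k) B ((t * B) ^+ 2)
    (C := fun i => H (c i)) (J := J) (reducible0 S k _); last first.
  have [ofk fk1] := f1 k.
  have -> : mean S (fun x => (f k x - B * 0) ^+ 2) = mean S (fun x => f k x ^+ 2).
    by congr (mean S _); apply: funext => x; rewrite mulr0 subr0.
  have : mean S (fun x => f k x ^+ 2) <= 1.
    apply: mean_le_cst => //; first exact: obsX.
    by move=> x; rewrite -[leLHS]ger0_norm ?sqr_ge0// normrX exprn_ile1.
  have [or _] := reducible_bobs (Hs _).1 red_r.
  have : 0 <= mean S (fun x => (f k x - B * r x) ^+ 2).
    apply: mean_ge0 => [|x]; last exact: sqr_ge0.
    by apply: obsX; apply: obsB => //; apply: (obsM (obs_cst _ _)).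
  by move: J1; lra.
move=> [i [r [iJ red_r min_r]]].
have sub i j := fsubset_chain (i := i) (j := j) Hinc.
have [or r1] := reducible_bobs (Hs _).1 red_r.
move: (red_r) => [W [s [l [w [u [l0 l1 w1 u1 rE]]]]]].
pose S' := prod_system S l0 l1.
(* On the copy of [X] with index [v], the factors [u v i] of [r] are absorbed into the first [k]
   functions. *)
pose f' i (y : W * X) := f i y.2 * u y.1 i y.2.
have f'1 j : bobs S' (f' j).
  split=> [|[v x]]; last by have [_] := bobsM (f1 j) (u1 v j); exact.
  by apply/obs_prod_system => v; have [] := bobsM (f1 j) (u1 v j).
have [j jN st] := HN (c i) _ S' f' f'1.
(* Strictness matters: [H (c i + j).+1] must also lie in [H (c i.+1)], where the formula for [r]
   holds. *)
have jc : (c i + j < c i.+1)%N by rewrite cS ltn_add2l.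
exists (c i + j)%N; first by rewrite (leq_trans jc)// c_le.
set Hj := H (c i + j)%N; set Hj1 := H (c i + j).+1 in st *.
move=> a b Ka Kb.
pose q x := f k x - B * r x.
have of_ i' : obs S (f i') by case: (f1 i').
have oq : obs S q by apply: obsB => //; apply: (obsM (obs_cst _ _)).
have olast v : obs S v -> forall i, obs S (set_last k f v i).
  by move=> ov i'; rewrite /set_last; case: eqP.
have split_last a' x : mavg S k.+1 f Hj a' x =
    B * mavg S k.+1 (set_last k f r) Hj a' x + mavg S k.+1 (set_last k f q) Hj a' x.
  rewrite -mavg_set_lastD -[in LHS](set_last_id k f); congr (mavg S _ _ _ _ _).
  by congr (set_last k f _); apply: funext => y; rewrite /q addrCA subrr addr0.
pose D x := mavg S k.+1 f Hj a x - mavg S k.+1 f Hj b x.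
pose Dr x := mavg S k.+1 (set_last k f r) Hj a x -
             mavg S k.+1 (set_last k f r) Hj b x.
have oD : obs S D by apply: obsB; exact: obs_mavg.
have oDr : obs S Dr by apply: obsB; apply: obs_mavg; exact: olast.
have D2 x : `|D x| <= 2.
  rewrite (le_trans (ler_normB _ _))// -[2]/(1 + 1).
  by apply: lerD; exact: mavg_norm_le1.
have obsZ z g : obs S g -> obs S (fun x => z * g x).
  by apply: obsM; exact: obs_cst.
(* [D] is bounded by 2 only, so the duality is applied to [D / 2] and [- D / 2]. *)
have D1 z : `|z| <= 2^-1 -> bobs S (fun x => z * D x).
  move=> z1; split=> [|x]; first exact: obsZ.
  by rewrite normrM -[leRHS](@mulVf _ 2)// ler_pM.
have dual z a' : `|z| <= 2^-1 ->
    mean S (fun x => z * D x * mavg S k.+1 (set_last k f q) Hj a' x) <= d.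
  move=> z1; apply: (@mean_mavg_last _ _ _ S k Hj (H (c i)) _ _ _ q) => //.
  - exact: Hs.
  - by rewrite sub// leq_addr.
  - by move=> i' ik; rewrite /set_last ltn_eqF.
  - by rewrite /set_last eqxx.
  - exact: D1.
  - move=> r' red_r'.
    have := near_minimizer_corr (f1 k) B0 t0 t1 (Hs _).1
      (reducible_sub (sub _ _ (c_le _ _ (leqnSn i))) red_r) min_r red_r'.
    move=> /le_trans; apply; rewrite tB /B.
    by rewrite (_ : _ + _ = d)//; field; rewrite gt_eqF.
have DrE x : Dr x = \sum_(v <- s) l v * (w v x *
    (mavg S' k f' Hj a (v, x) - mavg S' k f' Hj b (v, x))).
  have KK : (Hj `<=` H (c i.+1))%fset by rewrite sub// ltnW.
  have Kab : (Hj1 `<=` H (c i.+1))%fset by rewrite sub.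
  have E a' : a' \in Hj1 -> _ := fun Ka' => mavg_reducible f l0 l1 x
    (Hs _) KK (fsubsetP Kab _ Ka') rE.
  by rewrite /Dr !E// -sumrB; apply: eq_bigr => v _; rewrite -!mulrBr.
(* For [|z| <= 2], [z Q <= 2 n + Q ^ 2 / (2 n)], and stability on the product system bounds the mean
   of [Q ^ 2] by [n ^ 2]. *)
have mean_Dr : mean S (fun x => D x * Dr x) <= 5 / 2 * n.
  pose Q y := mavg S' k f' Hj a y - mavg S' k f' Hj b y.
  have oQ : obs S' Q by apply: obsB; apply: obs_mavg => i'; case: (f'1 i').
  have oDw : obs S' (fun y => D y.2 * w y.1 y.2).
    by apply/obs_prod_system => v'; apply: obsM => //; case: (w1 v').
  have -> : mean S (fun x => D x * Dr x) =
      mean S' (fun y => (D y.2 * w y.1 y.2) * Q y).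
    transitivity (mean S (fun x => \sum_(v <- s) l v * ((D x * w v x) * Q (v, x)))).
      congr (mean S _); apply: funext => x; rewrite DrE mulr_sumr.
      by apply: eq_bigr => v _; rewrite mulrCA; congr (_ * _); exact: mulrA.
    have o1 v : obs S (fun x => (D x * w v x) * Q (v, x)).
      exact: (obsM oDw oQ v).
    rewrite mean_sum; last by move=> v; exact: obsZ.
    by apply: eq_bigr => v _; rewrite meanZ.
  apply: (@le_trans _ _ (mean S' (fun y => (2 * n) * 1 + (2 * n)^-1 * Q y ^+ 2))).
    have oQ2 : obs S' (fun y => Q y ^+ 2) by exact: obsX.
    apply: ler_mean => [||[v x]]; first exact: obsM.
      apply: (obsD (obs_cst S' (2 * n * 1))); exact: (obsM (obs_cst S' _) oQ2).
    have n20 : 0 < 2 * n by rewrite mulr_gt0.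
    rewrite -(ler_pM2l n20).
    have : `|D x * w v x| <= 2.
      by have [_ /(_ x) wx] := w1 v; rewrite normrM -[2]mulr1 ler_pM.
    move: (D x * w v x) (Q (v, x)) => z y.
    rewrite ler_norml => /andP[z1 z2].
    rewrite mulrDr [X in _ + X]mulrA divff ?gt_eqF// mulr1 mul1r.
    have : 0 <= (n * z - y) ^+ 2 by exact: sqr_ge0.
    have z4 : z ^+ 2 <= 4 by nra.
    by have := ler_wpM2l (sqr_ge0 n) z4; lra.
  have oQ2 : obs S' (fun y => Q y ^+ 2) by exact: obsX.
  rewrite meanD ?meanZ//; last 3 first.
  - exact: obs_cst.
  - by apply: (obsM (obs_cst S' _)); exact: obs_cst.
  - exact: (obsM (obs_cst S' _) oQ2).
  have -> : 5 / 2 * n = (2 * n) * 1 + (2 * n)^-1 * n ^+ 2.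
    by field; rewrite gt_eqF.
  apply: lerD.
    by rewrite ler_pM2l ?mulr_gt0// mean1_le.
  by rewrite ler_pM2l ?invr_gt0 ?mulr_gt0//; exact: st.
have oAq a' : obs S (mavg S k.+1 (set_last k f q) Hj a').
  by apply: obs_mavg; exact: olast.
have oDA z a' : obs S (fun x => z * D x * mavg S k.+1 (set_last k f q) Hj a' x).
  by apply: obsM => //; exact: obsZ.
have oDDr : obs S (fun x => D x * Dr x) by exact: obsM.
(* One factor [D] of the square is split into its [B r] and [q] parts; the factors 2 undo the halves
   in [dual]. *)
have -> : mean S (fun x => (mavg S k.+1 f Hj a x - mavg S k.+1 f Hj b x) ^+ 2) =
    mean S (fun x => B * (D x * Dr x) +
      (2 * (2^-1 * D x * mavg S k.+1 (set_last k f q) Hj a x) +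
       2 * (- 2^-1 * D x * mavg S k.+1 (set_last k f q) Hj b x))).
  congr (mean S _); apply: funext => x; rewrite expr2 -/(D x).
  by rewrite {2}/D /Dr !split_last; field.
rewrite meanD; [|exact: obsZ|by apply: obsD; exact: obsZ].
rewrite meanD; [|exact: obsZ|exact: obsZ].
rewrite !meanZ//.
have := dual 2^-1 a; have := dual (- 2^-1) b.
rewrite normrN ger0_norm ?invr_ge0// => /(_ (lexx _)) d2 /(_ (lexx _)) d3.
have := ler_wpM2l (ltW B0) mean_Dr.
have -> : B * (5 / 2 * n) = e / 2.
  by rewrite /B /n /d; field; rewrite gt_eqF.
by move: d2 d3; rewrite /d; lra.
Qed.

Lemma uniform_stability k : uniformly_stable R G k.
Proof.
elim: k => [|k]; first exact: uniformly_stable0.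
exact: uniformly_stableS.
Qed.

End Induction.

(** * Averages along a Folner sequence *)

Lemma cvg_sum0 (R : realType) (I : Type) (s : seq I) (u : I -> nat -> R) :
  (forall i, (u i N @[N --> \oo] --> (0 : R))%classic) ->
  (\sum_(i <- s) u i N @[N --> \oo] --> (0 : R))%classic.
Proof.
move=> u0; elim: s => [|i s IH].
  by under eq_cvg do rewrite big_nil; exact: cvg_cst.
under eq_cvg do rewrite big_cons.
by have := cvgD (u0 i) IH; rewrite addr0; exact.
Qed.

Section Folner.
Variables (R : realType) (G : zmodType).
Implicit Types (H K A B : {fset G}).

(** The set of all [h + c a] with [c < n] is finite, and it is closed under subtraction because
    [n a = 0]. *)
Lemma fsubgroup_adjoin H a n : (0 < n)%N -> a *+ n = 0 -> fsubgroup H ->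
  exists K, [/\ fsubgroup K, (H `<=` K)%fset & a \in K].
Proof.
move=> n0 an HH.
have amod m : a *+ m = a *+ (m %% n).
  by rewrite {1}(divn_eq m n) mulrnDr mulnC mulrnA an mul0rn add0r.
pose K := [fset (h + a *+ (c : 'I_n))%R | h in H, c in [set: 'I_n]%SET]%fset.
have KP g : reflect (exists2 h, h \in H & exists m, g = h + a *+ m) (g \in K).
  apply: (iffP idP) => [/imfset2P[h Hh [c _ ->]]|[h Hh [m ->]]].
    by exists h => //; exists c.
  apply/imfset2P; exists h => //; exists (Ordinal (ltn_pmod m n0)) => /=.
    by rewrite inE.
  by rewrite -amod.
exists K; split.
- split; first by apply/KP; exists 0; [case: HH|exists 0%N; rewrite addr0].
  move=> _ _ /KP[h Hh [m ->]] /KP[h' Hh' [m' ->]]; apply/KP.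
  exists (h - h'); first exact: HH.2.
  (* [n - m' %% n] stands for [- m'], as multiples are counted in [nat]. *)
  exists (m + (n - m' %% n))%N; rewrite mulrnDr mulrnBr; last by rewrite ltnW// ltn_pmod.
  by rewrite an sub0r -amod opprD addrACA.
- apply/fsubsetP => h Hh; apply/KP; exists h => //.
  by exists 0%N; rewrite addr0.
- by apply/KP; exists 0; [case: HH|exists 1%N; rewrite add0r].
Qed.

(** If every [H] failed, adjoining to [H] an element [a] whose coset average is far off, and
    iterating, would build a chain that contradicts uniform stability. *)
Lemma uniform_coset_mean (X : Type) (S : psystem R G X) k (f : nat -> X -> R) e :
  (forall a : G, exists2 n, (0 < n)%N & a *+ n = 0) ->
  (forall i, bobs S (f i)) -> 0 < e ->
  exists2 H, fsubgroup H & forall a,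
    mean S (fun x => (mavg S k f H a x - mavg S k f H 0 x) ^+ 2) <= e.
Proof.
move=> tors f1 e0.
apply: contrapT => nex.
have bad (H : {H | fsubgroup H}) : exists K : {K | fsubgroup K},
    (sval H `<=` sval K)%fset /\ exists2 a, a \in sval K &
    ~ mean S (fun x => (mavg S k f (sval H) a x - mavg S k f (sval H) 0 x) ^+ 2) <= e.
  case: H => H HH /=; have [a Ha] : exists a,
      ~ mean S (fun x => (mavg S k f H a x - mavg S k f H 0 x) ^+ 2) <= e.
    by apply/existsNP => aH; apply: nex; exists H.
  have [n n0 an] := tors a; have [K [HK HsK Ka]] := fsubgroup_adjoin n0 an HH.
  by exists (exist _ K HK); split=> //; exists a.
have [next nextP] := choice bad.
have H0 : fsubgroup [fset (0 : G)]%fset.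
  by split=> [|a b]; rewrite ?inE// => /eqP-> /eqP->; rewrite subr0.
pose H j := iter j next (exist _ _ H0).
have Hs j : (sval (H j) `<=` sval (H j.+1))%fset by have [] := nextP (H j).
(* [uniformly_stable] is restricted to tolerances at most 1, hence the minimum. *)
have [||||N] := @uniform_stability R G k (Num.min e 1) (fun j => sval (H j)).
- by rewrite lt_min e0 ltr01.
- by rewrite ge_min lexx orbT.
- by move=> j; exact: (svalP (H j)).
- exact: Hs.
move=> /(_ X S f f1)[j _ st].
have [_ [a Ka]] := nextP (H j); apply.
apply: le_trans (st _ _ Ka _) _; first by have [] := svalP (H j.+1).
by rewrite ge_min lexx.
Qed.

Lemma sum_symdiff_le A B (F : G -> R) : (forall g, `|F g| <= 1) ->
  `|\sum_(g <- A) F g - \sum_(g <- B) F g| <= #|` symdiff A B|%:R.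
Proof.
move=> F1.
have sumD (C D : {fset G}) : \sum_(g <- C) F g =
    \sum_(g <- (C `&` D)%fset) F g + \sum_(g <- (C `\` D)%fset) F g.
  rewrite (big_fsetID _ (mem D)) /=; congr (_ + _); apply: eq_fbigl => g.
    by rewrite !inE.
  by rewrite !inE andbC.
have le_card (C : {fset G}) : `|\sum_(g <- C) F g| <= #|` C|%:R.
  rewrite (le_trans (ler_norm_sum _ _ _))// (le_trans (ler_sum _ (fun g _ => F1 g)))//.
  by rewrite big_const_seq count_predT iter_addr_0.
rewrite (sumD A B) (sumD B A) fsetIC opprD addrACA subrr add0r.
rewrite (le_trans (ler_normB _ _))// /symdiff.
have -> : #|` ((A `\` B) `|` (B `\` A))%fset| =
    (#|` (A `\` B)%fset| + #|` (B `\` A)%fset|)%N.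
  rewrite cardfsU (_ : (_ `&` _)%fset = fset0) ?cardfs0 ?subn0//.
  by apply/fsetP => g; rewrite !inE; case: (g \in A); rewrite ?andbF.
by rewrite natrD lerD.
Qed.

(** The difference of the two sides is the variance of [y] over [A]. *)
Lemma fmean_sqr_le A (y : G -> R) :
  ((#|` A|%:R)^-1 * \sum_(g <- A) y g) ^+ 2 <=
  (#|` A|%:R)^-1 * \sum_(g <- A) y g ^+ 2.
Proof.
have [->|A0] := eqVneq A fset0.
  by rewrite cardfs0 invr0 !mul0r expr0n.
set m := _ * _; rewrite -subr_ge0.
rewrite (_ : _ - _ = (#|` A|%:R)^-1 * \sum_(g <- A) (y g - m) ^+ 2).
  by rewrite mulr_ge0// sumr_ge0// => g _; exact: sqr_ge0.
rewrite [in RHS](eq_bigr (fun g => y g ^+ 2 + (- 2 * m * y g + m ^+ 2))); last first.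
  by move=> g _; ring.
rewrite !big_split !mulrDr /= fmean_cst// -mulr_sumr [X in _ + (X + _)]mulrCA -/m.
by ring.
Qed.

(** Let [M] be the mean, over [a] in [Phi N], of the averages over [a + H]. Exchanging sums makes
    [M] a mean over [h] in [H] of averages over [h + Phi N], each close to the average over [Phi N]
    by the Folner property. By convexity, [M] is close in mean square to the average over [H]. *)
Lemma Folner_mavg (X : Type) (S : psystem R G X) k (f : nat -> X -> R)
    (Phi : nat -> {fset G}) e :
  (forall a : G, exists2 n, (0 < n)%N & a *+ n = 0) ->
  is_Folner R Phi -> (forall i, bobs S (f i)) -> 0 < e ->
  exists2 q, obs S q & exists N0, forall N, (N0 <= N)%N ->
    mean S (fun x => (mavg S k f (Phi N) 0 x - q x) ^+ 2) <= e.
Proof.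
move=> tors [Phi0 PhiF] f1 e0.
have e40 : 0 < e / 4 by rewrite divr_gt0.
have [H HH Hst] := uniform_coset_mean k tors f1 e40.
have oA B a : obs S (mavg S k f B a) by apply: obs_mavg => i; case: (f1 i).
exists (mavg S k f H 0) => //.
pose rho N : R := (#|` H|%:R)^-1 * \sum_(h <- H)
  (#|` symdiff (translate h (Phi N)) (Phi N)|%:R / #|` Phi N|%:R).
have rho_ge0 N : 0 <= rho N.
  by rewrite mulr_ge0// sumr_ge0// => h _; rewrite divr_ge0.
have rho_cvg : (rho N @[N --> \oo] --> (0 : R))%classic.
  have := cvgMl_tmp (a := (#|` H|%:R)^-1) (cvg_sum0 (H : seq G) PhiF).
  by rewrite mulr0; exact.
(* The bound 1 is there to give [rho N ^ 2 <= rho N <= e / 4]. *)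
have [N0 _ N0P] : (\forall N \near \oo, rho N <= Num.min 1 (e / 4))%classic.
  have : 0 < Num.min 1 (e / 4) by rewrite lt_min ltr01.
  move=> /(cvgr0_norm_le _ rho_cvg); apply: filterS => N.
  by rewrite ger0_norm.
exists N0 => N /N0P /=; rewrite le_min => /andP[rho1 rhoe].
pose F g x := \prod_(i < k) f i (act S (g *+ i.+1) x).
have F1 x g : `|F g x| <= 1.
  by apply: (@prodr_norm_le1 _ (fun i => f i (act S (g *+ i.+1) x))) => i;
    case: (f1 i).
pose M x := (#|` Phi N|%:R)^-1 * \sum_(a <- Phi N) mavg S k f H a x.
have close x : `|mavg S k f (Phi N) 0 x - M x| <= rho N.
  have -> : M x = (#|` H|%:R)^-1 * \sum_(h <- H) ((#|` Phi N|%:R)^-1 *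
      \sum_(g <- translate h (Phi N)) F g x).
    rewrite /M /mavg -mulr_sumr mulrCA; congr (_ * _); rewrite -mulr_sumr.
    congr (_ * _); rewrite exchange_big; apply: eq_bigr => h _.
    rewrite big_imfset /=; last by move=> u v _ _; exact: addrI.
    by apply: eq_bigr => g _; rewrite addrC.
  have -> : mavg S k f (Phi N) 0 x = (#|` H|%:R)^-1 * \sum_(h <- H)
      ((#|` Phi N|%:R)^-1 * \sum_(g <- Phi N) F g x).
    rewrite fmean_cst ?fsubgroup_neq0//; congr (_ * _).
    by apply: eq_bigr => g _; rewrite add0r.
  rewrite -mulrBr -sumrB normrM ger0_norm// ler_wpM2l//.
  rewrite (le_trans (ler_norm_sum _ _ _))//; apply: ler_sum => h _.
  rewrite -mulrBr normrM ger0_norm// mulrC ler_wpM2r// distrC.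
  exact: sum_symdiff_le.
pose q a x := mavg S k f H a x - mavg S k f H 0 x.
have oq a : obs S (q a) by exact: obsB.
have oq2 a : obs S (fun x => q a x ^+ 2) by exact: obsX.
pose V x := (#|` Phi N|%:R)^-1 * \sum_(a <- Phi N) q a x ^+ 2.
have oV : obs S V by apply: (obsM (obs_cst _ _)); exact: obs_sum.
have MqV x : (M x - mavg S k f H 0 x) ^+ 2 <= V x.
  rewrite -[mavg S k f H 0 x](fmean_cst _ (Phi0 N)) -mulrBr -sumrB.
  exact: fmean_sqr_le.
(* From [(u - w) ^ 2 <= 2 (u - v) ^ 2 + 2 (v - w) ^ 2], where the first square is at most [e / 4]
   and the second at most [V], whose mean is at most [e / 4]. *)
apply: (@le_trans _ _ (mean S (fun x => e / 2 + 2 * V x))).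
  apply: ler_mean => [||x].
  - by apply: obsX; exact: obsB.
  - by apply: (obsD (obs_cst _ _)); exact: (obsM (obs_cst _ _)).
  have := close x; have := MqV x.
  move: (mavg S k f (Phi N) 0 x) (M x) (mavg S k f H 0 x) (V x) => u v w z.
  move=> vwz; rewrite ler_norml => /andP[uv1 uv2].
  have uv : (u - v) ^+ 2 <= e / 4.
    apply: le_trans rhoe; rewrite (@le_trans _ _ (rho N ^+ 2))//.
      by nra.
    by rewrite expr2 ler_piMl.
  have : 0 <= ((u - v) - (v - w)) ^+ 2 by exact: sqr_ge0.
  by nra.
rewrite meanD; [|exact: obs_cst|exact: (obsM (obs_cst _ _))].
rewrite (@meanZ _ _ _ S 2 V)//.
have : mean S (fun=> e / 2) <= e / 2.
  by apply: mean_le_cst; [apply: divr_ge0; exact: ltW|exact: obs_cst|].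
move=> le_e2; apply: (@le_trans _ _ (e / 2 + 2 * (e / 4))); last by lra.
apply: lerD; [exact: le_e2|rewrite ler_pM2l//].
rewrite /V /= meanZ ?mean_sum//; last exact: obs_sum.
by apply: fmean_le => [|a _]; [exact: ltW|exact: Hst].
Qed.

End Folner.

(** * Measure-preserving systems and L2 limits *)

Section MeasureSystem.
Local Open Scope classical_set_scope.
Context d (X : measurableType d) (R : realType) (mu : probability X R).
Implicit Types f : X -> R.

Definition bounded_measurable f :=
  measurable_fun setT f /\ exists M, forall x, `|f x| <= M.

Lemma bounded_measurable_integrable f : bounded_measurable f ->
  mu.-integrable setT (EFin \o f).
Proof.
move=> [mf [M fM]]; apply: measurable_bounded_integrable => //.
  by rewrite -ge0_fin_numE// fin_num_measure.
by exists M; split; [exact: num_real|move=> y My x _ /=; rewrite (le_trans (fM x))// ltW].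
Qed.

Lemma EFin_Rintegral f : bounded_measurable f ->
  (\int[mu]_x f x)%:E = (\int[mu]_x (f x)%:E)%E.
Proof.
move=> /bounded_measurable_integrable bf.
by rewrite /Rintegral fineK//; exact: integrable_fin_num.
Qed.

Lemma bounded_measurableD f g : bounded_measurable f -> bounded_measurable g ->
  bounded_measurable (fun x => f x + g x).
Proof.
move=> [mf [M fM]] [mg [N gN]]; split; first exact: measurable_funD.
by exists (M + N) => x; rewrite (le_trans (ler_normD _ _))// lerD.
Qed.

Lemma bounded_measurableM f g : bounded_measurable f -> bounded_measurable g ->
  bounded_measurable (fun x => f x * g x).
Proof.
move=> [mf [M fM]] [mg [N gN]]; split; first exact: measurable_funM.
by exists (M * N) => x; rewrite normrM ler_pM.
Qed.

Lemma bounded_measurable_cst (c : R) : bounded_measurable (fun=> c).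
Proof. by split; [exact: measurable_cst|exists `|c|]. Qed.

Lemma bounded_measurable_norm f : bounded_measurable f ->
  bounded_measurable (fun x => `|f x|).
Proof.
move=> [mf [M fM]]; split; first exact: measurableT_comp.
by exists M => x; rewrite normr_id.
Qed.

Variables (G : zmodType) (T : G -> X -> X).
Hypotheses (T0 : forall x, T 0 x = x)
  (TD : forall a b x, T (a + b) x = T a (T b x))
  (mT : forall a, measurable_fun setT (T a))
  (muT : forall a (A : set X), measurable A -> mu (T a @^-1` A) = mu A).

(** Change of variables: the image of [mu] under [T a] is [mu]. *)
Lemma Rintegral_act a f : bounded_measurable f ->
  \int[mu]_x f (T a x) = \int[mu]_x f x.
Proof.
move=> bf; have [mf [M fM]] := bf; rewrite /Rintegral; congr fine.
have bfT : bounded_measurable (f \o T a).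
  by split; [exact: measurableT_comp|exists M => x /=].
transitivity (\int[pushforward mu (T a)]_y (f y)%:E)%E.
  rewrite integral_pushforward ?preimage_setT//; first exact/measurable_EFinP.
  exact: bounded_measurable_integrable bfT.
by apply: eq_measure_integral => A mA _; exact: muT.
Qed.

Definition measure_psystem : psystem R G X.
Proof.
refine (@PSystem R G X bounded_measurable (fun f => \int[mu]_x f x) T
  _ _ _ _ _ _ _ _ _ T0 TD).
- exact: bounded_measurable_cst.
- exact: bounded_measurableD.
- exact: bounded_measurableM.
- move=> a f [mf [M fM]]; split; first exact: measurableT_comp.
  by exists M => x.
- by move=> f g /bounded_measurable_integrable ? /bounded_measurable_integrable ?;
    rewrite RintegralD.
- by move=> c f /bounded_measurable_integrable ?; rewrite RintegralZl.
- by move=> f _ f0; apply: Rintegral_ge0.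
- rewrite Rintegral_cst//.
  by rewrite mul1r [X in fine X]probability_setT.
- exact: Rintegral_act.
Defined.

End MeasureSystem.

Arguments measure_psystem : simpl never.

(** * Completeness of L2 for bounded functions *)

Section L2Limit.
Local Open Scope classical_set_scope.

(** From [j] on, the terms and hence the tail suprema lie in [[c - b, c + b]]. This controls a limit
    function that is defined as a pointwise [limn_sup]. *)
Lemma limn_sup_dist (R : realType) (w : nat -> R) (c b M : R) j :
  (forall i, `|w i| <= M) -> (forall i, (j <= i)%N -> `|w i - c| <= b) ->
  `|limn_sup w - c| <= b.
Proof.
move=> wM wcb.
have ubw : has_ubound (range w).
  by exists M => _ [i _ <-]; have := wM i; rewrite ler_norml => /andP[].
have lbw : has_lbound (range w).
  by exists (- M) => _ [i _ <-]; have := wM i; rewrite ler_norml => /andP[].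
have cvs : cvgn (sups w) by apply/cvg_ex; eexists; exact: cvg_sups_inf.
have wb i : (j <= i)%N -> c - b <= w i <= c + b.
  by move=> /wcb; rewrite ler_norml => /andP[? ?]; apply/andP; split; lra.
have supsb n : (j <= n)%N -> c - b <= sups w n <= c + b.
  move=> jn; apply/andP; split.
    have /andP[/le_trans + _] := wb _ jn; apply.
    by apply: ub_le_sup; [exact: has_ubound_sdrop|exists n => /=].
  apply: ge_sup; first by exists (w n); exists n => /=.
  by move=> _ [i /= ni <-]; have /andP[] := wb _ (leq_trans jn ni).
have lo : c - b <= limn (sups w).
  by apply: limr_ge => //; exists j => // n /= /supsb/andP[].
have hi : limn (sups w) <= c + b.
  by apply: limr_le => //; exists j => // n /= /supsb/andP[].
by rewrite ler_norml /limn_sup; apply/andP; split; lra.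
Qed.

Context d (X : measurableType d) (R : realType) (mu : probability X R).

(** The Riesz-Fischer argument along a rapidly converging subsequence [v]. Taking its [limn_sup]
    defines a measurable limit at every point, with the same bound 1. *)
Lemma bounded_L2_complete (u : nat -> X -> R) :
  (forall n, measurable_fun setT (u n)) -> (forall n x, `|u n x| <= 1) ->
  (forall e : R, 0 < e -> exists N0, forall m n, (N0 <= m)%N -> (N0 <= n)%N ->
     \int[mu]_x ((u m x - u n x) ^+ 2) <= e) ->
  exists F : X -> R, [/\ measurable_fun setT F, forall x, `|F x| <= 1 &
    \int[mu]_x ((u n x - F x) ^+ 2) @[n --> \oo] --> (0 : R)].
Proof.
move=> mu_ u1 cauchy; 
(* The trivial action of [int] makes the lemmas on means available for the integral. *)
pose S : psystem R int X := @measure_psystem _ _ _ mu _ (fun _ x => x)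
  (fun=> erefl) (fun _ _ _ => erefl) (fun=> @measurable_id _ _ setT)
  (fun _ _ _ => erefl).
have bobsP f : bobs S f <-> measurable_fun setT f /\ forall x, `|f x| <= 1.
  by split=> [[[? _] ?]|[? ?]]; [|split=> //; split=> //; exists 1].
have ou n : obs S (u n) by case: ((bobsP (u n)).2 (conj (mu_ n) (u1 n))).
have h0 j : 0 < (2^-1 : R) ^+ j by rewrite exprn_gt0.
have [Nf NfP] := choice (fun j =>
  cauchy (2^-1 ^+ j * 2^-1 ^+ j) (mulr_gt0 (h0 j) (h0 j))).
(* With partial sums, both [n_ j] and [n_ j.+1] are at least [Nf j]. *)
pose n_ j := (\sum_(i < j.+1) Nf i)%N; pose v j := u (n_ j).
have leN j : (Nf j <= n_ j)%N by rewrite /n_ big_ord_recr leq_addl.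
have leNS j : (Nf j <= n_ j.+1)%N.
  by rewrite (leq_trans (leN j))// /n_ [leqRHS]big_ord_recr leq_addr.
pose w j x := `|v j.+1 x - v j x|.
have ow j : obs S (w j).
  exact: (bounded_measurable_norm (obsB (ou (n_ j.+1)) (ou (n_ j)))).
have mean_w j : mean S (w j) <= 2^-1 ^+ j.
  have o2 : obs S (fun x => (v j.+1 x - v j x) ^+ 2).
    by apply: obsX; exact: (obsB (ou _) (ou _)).
  have := NfP j _ _ (leNS j) (leN j); rewrite -[\int[mu]_x _]/(mean S _).
  set a := mean S (fun x => (v j.+1 x - v j x) ^+ 2) => le_a.
  set e := 2^-1 ^+ j in le_a *; have e0 : 0 < e by exact: h0.
  (* Pointwise, [|y| <= e / 2 + y ^ 2 / (2 e)]. *)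
  apply: (@le_trans _ _ (mean S (fun x => e / 2 + (2 * e)^-1 *
      (v j.+1 x - v j x) ^+ 2))).
    apply: ler_mean => // [|x].
      by apply: (obsD (obs_cst _ _)); exact: (obsM (obs_cst _ _)).
    rewrite /w; set y := v _ _ - _; rewrite -(normr_id y) -real_normK ?num_real//.
    move: `|y| (normr_ge0 y) => z z0; rewrite ger0_norm//.
    rewrite -(ler_pM2l (mulr_gt0 (ltr0Sn R 1) e0)) mulrDr [X in _ + X]mulrA divff.
      by have := sqr_ge0 (z - e); nra.
    by rewrite gt_eqF// mulr_gt0.
  rewrite meanD; [|exact: obs_cst|exact: (obsM (obs_cst _ _))].
  rewrite (@meanZ _ _ _ S (2 * e)^-1 (fun x => (v j.+1 x - v j x) ^+ 2))// -/a.
  have : mean S (fun=> e / 2) <= e / 2.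
    by apply: mean_le_cst; [rewrite divr_ge0// ltW|exact: obs_cst|].
  have : (2 * e)^-1 * a <= e / 2.
    have -> : e / 2 = (2 * e)^-1 * (e * e) by field; rewrite gt_eqF.
    by rewrite ler_pM2l// invr_gt0 mulr_gt0.
  by lra.
(* [|F - v j|] is at most the sum of the [w i], [j <= i], at every point. *)
pose F x := limn_sup (v ^~ x).
have F1 x : `|F x| <= 1.
  by rewrite -[F x]subr0; apply: (@limn_sup_dist R _ _ _ 1 0) => [i|i _];
    rewrite ?subr0; exact: u1.
have mF : measurable_fun setT F.
  apply: measurable_fun_limn_sup => [x _|x _|j]; last exact: mu_.
    by exists 1 => _ [i _ <-]; have := u1 (n_ i) x; rewrite ler_norml => /andP[].
  by exists (-1) => _ [i _ <-]; have := u1 (n_ i) x; rewrite ler_norml => /andP[].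
have oF : obs S F by case: ((bobsP F).2 (conj mF F1)).
have oFv j : obs S (fun x => `|F x - v j x|).
  exact: (bounded_measurable_norm (obsB oF (ou (n_ j)))).
(* Integrate the series of the [w (j + n)] term by term and sum the geometric series. Where the
   series is infinite, the pointwise bound is trivial. *)
have mean_Fv j : mean S (fun x => `|F x - v j x|) <= 2 * 2^-1 ^+ j.
  pose h n x := (w (j + n)%N x)%:E.
  have h_ge0 n x : (0 <= h n x)%E by rewrite lee_fin normr_ge0.
  have le_part x n : `|v (j + n)%N x - v j x| <= \sum_(i < n) w (j + i)%N x.
    elim: n => [|n IH]; first by rewrite addn0 subrr normr0 big_ord0.
    rewrite big_ord_recr /= addnS addrC.
    rewrite -(subrK (v (j + n)%N x) (v (j + n).+1 x)) -addrA.
    by rewrite (le_trans (ler_normD _ _))// lerD.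
  have le_sum x : (`|F x - v j x|%:E <= \sum_(0 <= n <oo) h n x)%E.
    have part_le n : ((\sum_(i < n) w (j + i)%N x)%:E <= \sum_(0 <= n <oo) h n x)%E.
      by rewrite -sumEFin -(big_mkord xpredT (h ^~ x)); apply: nneseries_lim_ge.
    move: part_le; case: (\sum_(0 <= n <oo) h n x)%E => [r| |] part_le.
    - rewrite lee_fin; apply: (@limn_sup_dist R _ _ _ 1 j) => [i|i ji]; first exact: u1.
      have := part_le (i - j)%N; rewrite lee_fin; apply: le_trans.
      by have := le_part x (i - j)%N; rewrite subnKC.
    - exact: leey.
    - by have := part_le 0%N.
  rewrite -lee_fin EFin_Rintegral; last exact: oFv.
  apply: (@le_trans _ _ (\int[mu]_x \sum_(0 <= n <oo) h n x)%E).
    apply: ge0_le_integral => //.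
    - by apply/measurable_EFinP; case: (oFv j).
    - apply: ge0_emeasurable_sum => // n _.
      by apply/measurable_EFinP; case: (ow (j + n)%N).
  rewrite integral_nneseries//; last first.
    by move=> n; apply/measurable_EFinP; case: (ow (j + n)%N).
  apply: lime_le; first by apply: is_cvg_nneseries => n _ _; exact: integral_ge0.
  apply: nearW => n.
  apply: (@le_trans _ _ (\sum_(0 <= i < n) (2^-1 ^+ (j + i)%N)%:E)%E).
    apply: lee_sum => i _; rewrite -EFin_Rintegral; last exact: ow.
    by rewrite lee_fin; exact: mean_w.
  rewrite sumEFin lee_fin.
  suff : \sum_(0 <= i < n) 2^-1 ^+ (j + i)%N = 2 * 2^-1 ^+ j - 2 * 2^-1 ^+ (j + n)%N :> R.
    by move=> ->; rewrite gerBl mulr_ge0// ltW.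
  elim: n => [|n IH]; first by rewrite addn0 subrr big_geq.
  by rewrite big_nat_recr//= IH addnS exprS; field.
exists F; split=> //.
apply/(@pseudometric_normed_Zmodule.cvgrPdist_le R R) => e e0.
(* As [(F - v) ^ 2 <= 2 |F - v|], the final bound is [2 * 4 ^ - j + 4 * (2 * 2 ^ - j)], at most
   [10 * 2 ^ - j]. *)
have [j je] : exists j, 10 * 2^-1 ^+ j <= e.
  exists (Num.truncn (10 / e)).+1; set m := _.+1.
  rewrite exprVn ler_pdivrMr ?exprn_gt0// mulrC -ler_pdivrMr//.
  rewrite (le_trans (ltW (truncnS_gt _)))// -natrX ler_nat ltnW//.
  exact: ltn_expl.
exists (Nf j) => // n /= jn.
have oFn : obs S (fun x => u n x - F x) by exact: (obsB (ou n) oF).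
have oun : obs S (fun x => (u n x - v j x) ^+ 2).
  by apply: obsX; exact: (obsB (ou n) (ou _)).
have := NfP j _ _ jn (leN j); have := mean_Fv j.
rewrite -[\int[mu]_x (u n x - u (n_ j) x) ^+ 2]/(mean S (fun x => (u n x - v j x) ^+ 2)).
rewrite -[\int[mu]_x (u n x - F x) ^+ 2]/(mean S (fun x => (u n x - F x) ^+ 2)).
rewrite sub0r normrN ger0_norm; last first.
  by apply: mean_ge0 => [|x]; [exact: obsX|exact: sqr_ge0].
move=> le1 le2.
apply: (@le_trans _ _ (mean S (fun x => 2 * (u n x - v j x) ^+ 2 + 4 * `|F x - v j x|))).
  apply: ler_mean => [||x]; first exact: obsX.
    by apply: obsD; apply: (obsM (obs_cst _ _)).
  have : `|F x - v j x| ^+ 2 <= 2 * `|F x - v j x|.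
    rewrite expr2 ler_wpM2r// (le_trans (ler_normB _ _))// -[2]/(1 + 1).
    by apply: lerD; [exact: F1|exact: u1].
  rewrite real_normK ?num_real//.
  move: (`|F x - v j x|) (u n x) (F x) (v j x) => z a b c.
  by have := sqr_ge0 ((a - c) - (c - b)); nra.
rewrite meanD; [|exact: (obsM (obs_cst _ _))|exact: (obsM (obs_cst _ _))].
rewrite !meanZ//.
have e1 : 2^-1 ^+ j * 2^-1 ^+ j <= 2^-1 ^+ j :> R.
  by rewrite ler_piMl// ?exprn_ge0// exprn_ile1// invf_le1// ler1n.
by move: le1 le2 e1 je; lra.
Qed.

End L2Limit.

(** * Complex-valued functions *)

Section ComplexAlgebra.
Variable R : rcfType.
Implicit Types z w : R[i].
Local Notation Re := complex.Re.
Local Notation Im := complex.Im.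

Lemma ReD z w : Re (z + w) = Re z + Re w. Proof. by case: z; case: w. Qed.
Lemma ImD z w : Im (z + w) = Im z + Im w. Proof. by case: z; case: w. Qed.
Lemma ReM z w : Re (z * w) = Re z * Re w - Im z * Im w.
Proof. by case: z; case: w. Qed.
Lemma ImM z w : Im (z * w) = Re z * Im w + Im z * Re w.
Proof. by case: z; case: w. Qed.

Lemma Re_lincomb (J : Type) (s : seq J) (z : J -> R[i]) (r : J -> R) :
  Re (\sum_(j <- s) z j * (r j)%:C%C) = \sum_(j <- s) Re (z j) * r j.
Proof.
elim: s => [|j s IH]; first by rewrite !big_nil.
by rewrite !big_cons ReD IH ReM /= mulr0 subr0.
Qed.

Lemma Im_lincomb (J : Type) (s : seq J) (z : J -> R[i]) (r : J -> R) :
  Im (\sum_(j <- s) z j * (r j)%:C%C) = \sum_(j <- s) Im (z j) * r j.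
Proof.
elim: s => [|j s IH]; first by rewrite !big_nil.
by rewrite !big_cons ImD IH ImM /= mulr0 add0r.
Qed.

Lemma normc_sqr z : ComplexField.Normc.normc z ^+ 2 = Re z ^+ 2 + Im z ^+ 2.
Proof. by case: z => a b /=; rewrite sqr_sqrtr// addr_ge0// sqr_ge0. Qed.

(** A crude constant, by induction from [(a + b) ^ 2 <= 2 a ^ 2 + 2 b ^ 2]; it only has to be
    independent of [y]. *)
Lemma sqr_sum_le (J : Type) (s : seq J) (y : J -> R) :
  (\sum_(j <- s) y j) ^+ 2 <= 2 ^+ size s * \sum_(j <- s) y j ^+ 2.
Proof.
elim: s => [|j s IH]; first by rewrite !big_nil expr0n mulr0.
rewrite !big_cons /= (exprS _ (size s)).
set Y := \sum_(_ <- _) _; set Q := \sum_(_ <- _) _.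
have : 1 <= 2 ^+ size s :> R by rewrite exprn_ege1// ler1n.
move: IH; rewrite -/Y -/Q; move: (2 ^+ size s) => c IH c1.
have : y j ^+ 2 <= c * y j ^+ 2 by rewrite ler_peMl// sqr_ge0.
by have := sqr_ge0 (y j - Y); lra.
Qed.

End ComplexAlgebra.

Section ComplexMeasurable.
Local Open Scope classical_set_scope.
Context d (X : measurableType d) (R : realType).
Implicit Types h : X -> R[i].

(** Stated on real and imaginary parts, to match [in_CLp]. *)
Definition cmeasurable h := measurable_fun setT (fun x => complex.Re (h x)) /\
  measurable_fun setT (fun x => complex.Im (h x)).

Lemma cmeasurable_cst (z : R[i]) : cmeasurable (fun=> z).
Proof. by split; exact: measurable_cst. Qed.

Lemma cmeasurableD h1 h2 : cmeasurable h1 -> cmeasurable h2 ->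
  cmeasurable (fun x => h1 x + h2 x).
Proof.
move=> [r1 i1] [r2 i2]; split.
  under eq_fun do rewrite ReD; exact: measurable_funD.
under eq_fun do rewrite ImD; exact: measurable_funD.
Qed.

Lemma cmeasurableM h1 h2 : cmeasurable h1 -> cmeasurable h2 ->
  cmeasurable (fun x => h1 x * h2 x).
Proof.
move=> [r1 i1] [r2 i2]; split.
  under eq_fun do rewrite ReM.
  by apply: measurable_funB; exact: measurable_funM.
under eq_fun do rewrite ImM.
by apply: measurable_funD; exact: measurable_funM.
Qed.

Lemma cmeasurable_sum (J : Type) (s : seq J) (h : J -> X -> R[i]) :
  (forall j, cmeasurable (h j)) -> cmeasurable (fun x => \sum_(j <- s) h j x).
Proof.
move=> mh; elim: s => [|j s IH].
  by under eq_fun do rewrite big_nil; exact: cmeasurable_cst.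
by under eq_fun do rewrite big_cons; exact: cmeasurableD.
Qed.

Lemma cmeasurable_prod (J : Type) (s : seq J) (h : J -> X -> R[i]) :
  (forall j, cmeasurable (h j)) -> cmeasurable (fun x => \prod_(j <- s) h j x).
Proof.
move=> mh; elim: s => [|j s IH].
  by under eq_fun do rewrite big_nil; exact: cmeasurable_cst.
by under eq_fun do rewrite big_cons; exact: cmeasurableM.
Qed.

Variable mu : probability X R.

Lemma Lfun_pinfty_bounded (f : X -> R) : f \in Lfun mu +oo%E ->
  measurable_fun setT f /\ exists M : R, \forall x \ae mu, `|f x| <= M.
Proof.
rewrite inE => /andP[]; rewrite inE /= => mf; rewrite inE /= /finite_norm unlock.
(* The norm of exponent [+oo] is the essential supremum when the space has positive measure. *)
have mu_gt0 : (0 < (mu : {measure set X -> \bar R}) setT)%E.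
  by change (0 < mu setT)%E; rewrite probability_setT.
rewrite mu_gt0 => fin; split=> //.
exact: ess_supr_bounded fin.
Qed.

Lemma bounded_measurable_Lfun2 (f : X -> R) : bounded_measurable f ->
  f \in Lfun mu 2%:E.
Proof.
move=> bf; have [mf _] := bf; rewrite inE; apply/andP; split; rewrite inE//=.
rewrite /finite_norm unlock; apply: poweR_lty.
under eq_integral.
  move=> x _ /=; rewrite powR_mulrn// real_normK ?num_real//; over.
have /(bounded_measurable_integrable mu) : bounded_measurable (fun x => f x * f x).
  exact: bounded_measurableM.
move=> /integrable_fin_num -/(_ measurableT); rewrite ge0_fin_numE//.
by apply: integral_ge0 => x _; rewrite lee_fin -expr2 sqr_ge0.
Qed.

End ComplexMeasurable.

Section Convergence.
Local Open Scope classical_set_scope.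
Context d (R : realType) (X : measurableMetricType d R) (mu : probability X R).

(** The distance is squeezed between 0 and the square root of the integral of [B N]. An almost
    everywhere bound suits functions that are only essentially bounded. *)
Lemma CL2dist_cvg0 (u : nat -> X -> R[i]) (F : X -> R[i]) (B : nat -> X -> R) :
  (forall N, cmeasurable (fun x => u N x - F x)) ->
  (forall N, bounded_measurable (B N)) -> (forall N x, 0 <= B N x) ->
  (forall N, \forall x \ae mu,
    complex.Re (u N x - F x) ^+ 2 + complex.Im (u N x - F x) ^+ 2 <= B N x) ->
  \int[mu]_x B N x @[N --> \oo] --> (0 : R) ->
  CL2dist mu (u N) F @[N --> \oo] --> 0%E.
Proof.
move=> muF bB B0 le_B cvg_B.
pose q N x := complex.Re (u N x - F x) ^+ 2 + complex.Im (u N x - F x) ^+ 2.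
have q0 N x : 0 <= q N x by rewrite addr_ge0// sqr_ge0.
have mq N : measurable_fun setT (q N).
  by have [mr mi] := muF N; apply: measurable_funD; exact: measurable_funX.
apply: (@squeeze_cvge _ _ _ _ (cst 0%E) _
    (fun N => (Num.sqrt (\int[mu]_x B N x))%:E)); last 2 first.
- exact: cvg_cst.
- apply: cvg_EFin; first exact: nearW.
  rewrite -[X in _ --> X]sqrtr0; apply: cvg_comp cvg_B _.
  exact: sqrt_continuous.
apply: nearW => N; rewrite Lnorm_ge0 /=.
rewrite /CL2dist unlock -powR12_sqrt; last by apply: Rintegral_ge0.
rewrite -poweR_EFin EFin_Rintegral//; apply: gt0_ler_poweR.
- by rewrite invr_ge0.
- by rewrite in_itv/= leey andbT integral_ge0.
- by rewrite in_itv/= leey andbT integral_ge0// => x _; rewrite lee_fin.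
under eq_integral => x _.
  rewrite /= powR_mulrn// real_normK ?num_real// normc_sqr -/(q N x).
  over.
apply: ae_ge0_le_integral => //.
- by move=> x _; rewrite lee_fin.
- exact/measurable_EFinP.
- by move=> x _; rewrite lee_fin.
- by apply/measurable_EFinP; case: (bB N).
- by apply: filterS (le_B N) => x qB _; rewrite lee_fin.
Qed.

End Convergence.

(** Distributing the product over the sums, each choice [c] of one summand per factor gives a real
    average with a complex coefficient. The hypothesis concerns a single [x], so that it can be met
    off a null set. *)
Lemma multiple_average_expand (R : realType) (G : zmodType) (X : Type)
    (S : psystem R G X) k (f : 'I_k.+1 -> X -> R[i]) (z : bool -> R[i])
    (r : 'I_k.+1 -> bool -> X -> R) (A : {fset G}) x :
  (forall (g : G) (j : 'I_k.+1), g \in A -> f j (act S (g *+ j.+1) x) =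
     \sum_(b : bool) z b * (r j b (act S (g *+ j.+1) x))%:C%C) ->
  (#|` A|%:R)^-1 * \sum_(g <- A) \prod_(j < k.+1) f j (act S (g *+ j.+1) x) =
  \sum_(c : {ffun 'I_k.+1 -> bool}) (\prod_j z (c j)) *
    (mavg S k.+1 (fun i => r (inord i) (c (inord i))) A 0 x)%:C%C.
Proof.
move=> fE.
under eq_big_seq => g Ag.
  under eq_bigr => j _ do rewrite fE//.
  rewrite bigA_distr_bigA; over.
rewrite /= exchange_big mulr_sumr; apply: eq_bigr => c _ /=.
rewrite rmorphM fmorphV rmorph_nat rmorph_sum /= mulrCA; congr (_ * _).
rewrite mulr_sumr; apply: eq_bigr => g _.
rewrite big_split rmorph_prod add0r; congr (_ * _).
by apply: eq_bigr => j _; rewrite inord_val.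
Qed.

(** * Convergence of the averages *)

Section BoundedMeans.
Local Open Scope classical_set_scope.
Context d (X : measurableType d) (R : realType) (mu : probability X R).
Variables (G : zmodType) (T : G -> X -> X).
Hypotheses (T0 : forall x, T 0 x = x)
  (TD : forall a b x, T (a + b) x = T a (T b x))
  (mT : forall a, measurable_fun setT (T a))
  (muT : forall a (A : set X), measurable A -> mu (T a @^-1` A) = mu A).

(** The exceptional null set is pulled back by [T a], which preserves its measure. *)
Lemma ae_act (P : X -> Prop) a : (\forall x \ae mu, P x) ->
  \forall x \ae mu, P (T a x).
Proof.
move=> [N [mN muN PN]]; exists (T a @^-1` N); split.
- by rewrite -[X in measurable X]setTI; exact: mT.
- by rewrite muT.
- by move=> x /= nP; exact: (PN (T a x)).
Qed.

Let S := measure_psystem T0 TD mT muT.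

Lemma mavg_L2_cvg k (f : nat -> X -> R) (Phi : nat -> {fset G}) :
  (forall a : G, exists2 n, (0 < n)%N & a *+ n = 0) ->
  is_Folner R Phi -> (forall i, bobs S (f i)) ->
  exists F, bobs S F /\
    \int[mu]_x ((mavg S k f (Phi N) 0 x - F x) ^+ 2) @[N --> \oo] --> (0 : R).
Proof.
move=> tors PhiF f1.
have oA N : obs S (mavg S k f (Phi N) 0) by apply: obs_mavg => i; case: (f1 i).
have [|||F [mF F1 cvgF]] := @bounded_L2_complete _ X R mu
    (fun N => mavg S k f (Phi N) 0).
- by move=> N; case: (oA N).
- by move=> N x; exact: mavg_norm_le1.
(* Two averages are compared through [q], at the cost [2 (e / 4) + 2 (e / 4)]. *)
- move=> e e0; have e4 : 0 < e / 4 by rewrite divr_gt0.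
  have [q oq [N0 N0P]] := Folner_mavg k tors PhiF f1 e4.
  exists N0 => m n /N0P m1 /N0P n1.
  have osq (g h : X -> R) : obs S g -> obs S h ->
      obs S (fun x => 2 * (g x - h x) ^+ 2).
    by move=> og oh; apply: (obsM (obs_cst S 2)); apply: obsX; exact: obsB.
  apply: (@le_trans _ _ (mean S (fun x => 2 * (mavg S k f (Phi m) 0 x - q x) ^+ 2 +
      2 * (mavg S k f (Phi n) 0 x - q x) ^+ 2))).
    apply: (ler_mean (S := S)) => [||x].
    - by apply: obsX; exact: obsB.
    - by apply: obsD; exact: osq.
    move: (mavg _ _ _ _ _ _) (mavg _ _ _ _ _ _) (q x) => u v w.
    by have := sqr_ge0 ((u - w) + (v - w)); nra.
  rewrite meanD; [|exact: osq|exact: osq].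
  by rewrite !meanZ; [lra|apply: obsX; exact: obsB|apply: obsX; exact: obsB].
by exists F; split=> //; split=> //; split=> //; exists 1.
Qed.

End BoundedMeans.

(** The product of the [p i] over the finite support of [a] annihilates every coordinate. *)
Lemma Zsum_torsion (I : choiceType) (p : I -> nat) :
  (forall i, prime (p i)) -> forall a : Zsum p, exists2 n, (0 < n)%N & a *+ n = 0.
Proof.
move=> p_prime a.
have mulE n i : (a *+ n) i = a i *+ n.
  by elim: n => [|n IH]; rewrite ?mulr0n// !mulrS -IH.
have pa i : a i *+ p i = 0.
  by rewrite -mulr_natr pchar_Zp ?mulr0// prime_gt1.
pose s := fset_set [set i | a i != 0]%classic.
exists (\prod_(i <- s) p i)%N; first by rewrite prodn_gt0// => i; exact: prime_gt0.
apply: dsumP => i; rewrite mulE.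
have [->|ai0] := eqVneq (a i) 0; first by rewrite mul0rn.
have is_ : i \in s by rewrite in_fset_set ?inE//; exact: dsum_finite.
by rewrite (big_fsetD1 i)//= mulrnA pa mul0rn.
Qed.

Theorem theorem2p13 (R : realType) (d : measure_display)
    (I : countType) (p : I -> nat) (p_prime : forall i, prime (p i))
    (X : measurableMetricType d R) (mu : probability X R)
    (T : Zsum p -> X -> X)
    (T_system : is_system mu T) (T_ergodic : is_ergodic mu T)
    (k : nat) (k_min : forall i, (k + 1 <= p i)%N)
    (f : 'I_k.+1 -> X -> R[i]) (f_Linfty : forall j, in_CLp mu +oo%E (f j))
    (Phi : nat -> {fset (Zsum p)}) (Phi_Folner : is_Folner R Phi) :
  converges_in_L2 mu (fun N => multiple_average T f (Phi N)).
Proof.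
have [_ T0 TD mT muT] := T_system.
pose S := measure_psystem T0 TD mT muT.
pose h (jb : 'I_k.+1 * bool) x :=
  if jb.2 then complex.Im (f jb.1 x) else complex.Re (f jb.1 x).
have hP jb : measurable_fun setT (h jb) /\ exists M : R, \forall x \ae mu, `|h jb x| <= M.
  case: jb => j [|]; rewrite /h /=; have [fr fi] := f_Linfty j.
    exact: Lfun_pinfty_bounded fi.
  exact: Lfun_pinfty_bounded fr.
have [Mh MhP] := choice (fun jb => (hP jb).2).
(* A common bound for all real and imaginary parts; the 1 makes it positive, so that one can divide
   by it. *)
pose M := 1 + \sum_jb `|Mh jb|.
have M0 : 0 < M by rewrite ltr_pwDl// sumr_ge0.
have hM jb : \forall x \ae mu, `|h jb x| <= M.
  apply: filterS (MhP jb) => x /le_trans; apply.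
  rewrite /M (bigD1 jb)//= addrCA (le_trans (ler_norm _))// lerDl.
  by rewrite addr_ge0// sumr_ge0.
(* Clamping to [[-1, 1]] gives functions bounded at every point, as [bobs] demands; almost
   everywhere they agree with [h / M]. *)
pose r j b x := Num.max (-1) (Num.min 1 (h (j, b) x / M)).
have r1 j b : bobs S (r j b).
  have rle x : `|r j b x| <= 1.
    rewrite ler_norml /r le_max lexx ge_max ge_min lexx andbT /=.
    by rewrite -subr_ge0 opprK addr_ge0.
  split=> //; split; last by exists 1.
  apply: measurable_maxr; first exact: measurable_cst.
  apply: measurable_minr; first exact: measurable_cst.
  by apply: measurable_funM; [exact: (hP (j, b)).1|exact: measurable_cst].
pose z (b : bool) : R[i] := (M%:C * (if b then 'i else 1))%C.
have fE j x : (forall b, `|h (j, b) x| <= M) ->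
    f j x = \sum_(b : bool) z b * (r j b x)%:C%C.
  move=> hx; have rE b : r j b x = h (j, b) x / M.
    have := hx b; rewrite ler_norml => /andP[lo hi].
    rewrite /r min_r ?max_r//; first by rewrite ler_pdivlMr// mulN1r.
    by rewrite ler_pdivrMr// mul1r.
  rewrite big_bool /= !rE /z /h /=; case: (f j x) => u v.
  by apply/eqP; rewrite eq_complex; apply/andP; split; apply/eqP;
    rewrite ?ReD ?ImD ?ReM ?ImM /=; field; rewrite gt_eqF.
pose fc (c : {ffun 'I_k.+1 -> bool}) (i : nat) := r (inord i) (c (inord i)).
have fc1 c i : bobs S (fc c i) by exact: r1.
have tors := Zsum_torsion p_prime.
(* One limit for each choice [c] of real or imaginary parts; [F] combines them with the coefficients
   [zc c]. *)
have [Fc FcP] := choice (fun c => mavg_L2_cvg k.+1 tors Phi_Folner (fc1 c)).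
pose zc (c : {ffun 'I_k.+1 -> bool}) := \prod_j z (c j).
pose F x := \sum_c zc c * (Fc c x)%:C%C.
have oFc c : obs S (Fc c) by have [[]] := FcP c.
pose A c N := mavg S k.+1 (fc c) (Phi N) 0.
have oA c N : obs S (A c N) by apply: obs_mavg => i; case: (fc1 c i).
have oZ (a : R) g : obs S g -> obs S (fun x => a * g x).
  by apply: obsM; exact: obs_cst.
have oReF : obs S (fun x => complex.Re (F x)).
  rewrite (_ : (fun x => _) = fun x => \sum_c complex.Re (zc c) * Fc c x).
    by apply: obs_sum => c; exact: oZ.
  by apply: funext => x; rewrite Re_lincomb.
have oImF : obs S (fun x => complex.Im (F x)).
  rewrite (_ : (fun x => _) = fun x => \sum_c complex.Im (zc c) * Fc c x).
    by apply: obs_sum => c; exact: oZ.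
  by apply: funext => x; rewrite Im_lincomb.
exists F; first by split; exact: bounded_measurable_Lfun2.
pose s := index_enum {ffun 'I_k.+1 -> bool}.
pose n := size s.
(* These weights result from [sqr_sum_le], applied to the real and to the imaginary part. *)
pose w c := 2 ^+ n * (complex.Re (zc c) ^+ 2 + complex.Im (zc c) ^+ 2).
have oD c N : obs S (fun x => (A c N x - Fc c x) ^+ 2).
  by apply: obsX; exact: obsB.
apply: (@CL2dist_cvg0 _ _ _ _ _ _ (fun N x => \sum_c w c * (A c N x - Fc c x) ^+ 2)).
- move=> N; rewrite /multiple_average.
  rewrite (_ : (fun x => _) = fun x => (#|` Phi N|%:R)^-1 *
      (\sum_(g <- Phi N) \prod_(j < k.+1) f j (T (g *+ j.+1) x)) + (-1) * F x).
    apply: cmeasurableD; (apply: cmeasurableM; first exact: cmeasurable_cst);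
      last by split; [case: oReF|case: oImF].
    apply: cmeasurable_sum => g; apply: cmeasurable_prod => j.
    have [mr _] := hP (j, false); have [mi _] := hP (j, true).
    split; [exact: (measurableT_comp mr (mT _))|exact: (measurableT_comp mi (mT _))].
  by apply: funext => x; rewrite mulN1r.
- by move=> N; apply: (obs_sum (S := S)) => c; exact: oZ.
- move=> N x; apply: sumr_ge0 => c _; rewrite mulr_ge0 ?sqr_ge0//.
  by rewrite mulr_ge0 ?exprn_ge0// addr_ge0 ?sqr_ge0.
- move=> N.
  (* Only finitely many null sets are discarded, one for each [g] in [Phi N], each [j] and each
     [b]. *)
  have : \forall x \ae mu, forall (g : Phi N) (j : 'I_k.+1) (b : bool),
      `|h (j, b) (T (val g *+ j.+1) x)| <= M.
    apply: filter_forall => g; apply: filter_forall => j; apply: filter_forall => b.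
    exact: (ae_act mT muT _ (hM (j, b))).
  apply: filterS => x hx.
  have -> : multiple_average T f (Phi N) x - F x =
      \sum_c zc c * (A c N x - Fc c x)%:C%C.
    rewrite /multiple_average (multiple_average_expand (S := S) (z := z) (r := r)).
      rewrite /F -sumrB; apply: eq_bigr => c _.
      by rewrite -mulrBr -rmorphB.
    by move=> g j Ag; apply: fE => b; exact: (hx [` Ag]%fset).
  rewrite Re_lincomb Im_lincomb.
  rewrite (le_trans (lerD (sqr_sum_le _ _) (sqr_sum_le _ _)))//.
  rewrite -/s -/n -mulrDr -big_split mulr_sumr; apply: ler_sum => c _ /=.
  by rewrite /w !exprMn -mulrDl mulrA.
rewrite (_ : (fun N => _) = fun N => \sum_c w c * \int[mu]_x ((A c N x - Fc c x) ^+ 2)).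
  apply: cvg_sum0 => c; have [_ cvgc] := FcP c.
  by have := cvgMl_tmp (a := w c) cvgc; rewrite mulr0; exact.
apply: funext => N.
rewrite -[LHS]/(mean S (fun x => \sum_c w c * (A c N x - Fc c x) ^+ 2)).
rewrite mean_sum => [|c]; last exact: oZ.
by apply: eq_bigr => c _; rewrite (meanZ (w c) (oD c N)).
Qed.
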